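(* Each of the following $\mathbb{C}$-linear maps $M_3(\mathbb{C})\to M_3(\mathbb{C})$, written in terms of $Z=[z_{ij}]_{i,j=0}^2$, is an extremal positive map. (I) For every $t\in\mathbb{R}\setminus\{1,-1\}$, the map $$Z\mapsto\begin{bmatrix}(t^2-1)^2 z_{00}+z_{11}+t^4 z_{22}&-(t^4-t^2+1)z_{01}&-(t^4-t^2+1) z_{02} \\ -(t^4-t^2+1) z_{10} & t^4 z_{00}+(t^2-1)^2 z_{11}+z_{22} &-(t^4-t^2+1) z_{12}\\ -(t^4-t^2+1) z_{20} & -(t^4-t^2+1) z_{21} & z_{00}+t^4 z_{11}+ (t^2-1)^2 z_{22}\end{bmatrix}.$$ (II) For every $$(p,q)\in\left\{(p,q)\in[0,1/\sqrt2]\times[0,\sqrt2]\colon 2p-q\ge0,\ (p^2-1)^2q^2-p^2\ge0\right\}\setminus\left\{(0,0),\left(\tfrac1{\sqrt2},\sqrt2\right)\right\},$$ the map $Z\mapsto[w_{ij}]_{i,j=0}^2$ with $$\begin{aligned} w_{00}&=p^2(pq-1)^2 z_{00}+q(2p-q)z_{11},\\ w_{11}&=p^2q^3(2p-q)z_{00}+q^2(pq-1)^2z_{11}+q(2p-q)z_{22},\\ w_{22}&=q(2p-q)(1-p^2q^2)z_{00}+p^2q^3(2p-q)z_{11}+p^2(pq-1)^2z_{22},\\ w_{01}&=-pq(1-q^2+p^2q^2)z_{01},\qquad w_{10}=-pq(1-q^2+p^2q^2)z_{10},\\ w_{12}&=-pq(1-q^2+p^2q^2)z_{12},\qquad w_{21}=-pq(1-q^2+p^2q^2)z_{21},\\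 w_{02}&=(pq-1)(p^2+pq-p^3q-q^2+p^2q^2)z_{02},\\ w_{20}&=(pq-1)(p^2+pq-p^3q-q^2+p^2q^2)z_{20}. \end{aligned}$$ (III) For every $(m,n)\in[-1,1]^2\setminus\{(0,0)\}$ such that $$b:=\min\left\{-2mn-m^2n^2-n^2,\ -2mn-m^2n^2-m^2\right\}\ge0,$$ and with $$c:=\max\left\{-\tfrac12mn\left(1+mn-\sqrt{1-m^2}\right),\ -\tfrac12mn\left(1+mn-\sqrt{1-n^2}\right)\right\},$$ the map $$Z\mapsto b\begin{bmatrix} z_{11} & 0 & -z_{02} \\ 0 & z_{22} & -z_{12} \\ -z_{20} & -z_{21} & z_{00}+z_{22} \end{bmatrix}+c\begin{bmatrix} 0 & z_{01}-z_{10} & 0 \\ z_{10}-z_{01} & 0 & 0 \\ 0 & 0 & 0 \end{bmatrix}+[u_{ij}]_{i,j=0}^2,$$ where $$\begin{aligned} u_{00}&=n^2\left(z_{00}+m(z_{01}+z_{10})+m^2z_{11}\right),\\ u_{01}&=-mn\left(nz_{00}-z_{01}+mnz_{10}-mz_{11}\right),\\ u_{02}&=-n(m+n)(z_{02}+mz_{12}),\\ u_{10}&=-mn\left(nz_{00}-z_{10}+mnz_{01}-mz_{11}\right),\\ u_{11}&=m^2\left(n^2z_{00}-n(z_{01}+z_{10})+z_{11}\right),\\ u_{12}&=m(m+n)(nz_{02}-z_{12}),\\ u_{20}&=-n(m+n)(z_{20}+mz_{21}),\\ u_{21}&=m(m+n)(nz_{20}-z_{21}),\\ u_{22}&=(m+n)^2z_{22}.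 \end{aligned}$$
   Context: Rows and columns of $3\times3$ matrices are indexed by $0,1,2$. A linear map $\Phi\colon M_3(\mathbb{C})\to M_3(\mathbb{C})$ is positive if it maps (Hermitian) positive semidefinite matrices to positive semidefinite matrices. A positive map $M_3(\mathbb{C})\to M_3(\mathbb{C})$ is extremal if it cannot be written as a sum of two linearly independent positive maps $M_3(\mathbb{C})\to M_3(\mathbb{C})$. *)

(* Defs.v *)
From mathcomp Require Import all_boot all_order all_algebra.
From mathcomp Require Import reals.
From mathcomp Require Import complex.

Set Implicit Arguments.
Unset Strict Implicit.
Unset Printing Implicit Defensive.

Import Order.TTheory GRing.Theory Num.Theory.
Local Open Scope ring_scope.
Local Open Scope complex_scope.
Local Open Scope sesquilinear_scope.

(* The order on a numClosedFieldType is partial: [0 <= x] says that [x] is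
   real and nonnegative. *)
Definition psdmx (C : numClosedFieldType) (n : nat) (A : 'M[C]_n) : Prop :=
  A \is hermsymmx /\ forall v : 'cV[C]_n, 0 <= (v ^t* *m A *m v) 0 0.

Definition positive_map (C : numClosedFieldType) (n : nat)
    (f : 'M[C]_n -> 'M[C]_n) : Prop :=
  linear f /\ forall Z, psdmx Z -> psdmx (f Z).

Definition extremal_positive_map (C : numClosedFieldType) (n : nat)
    (f : 'M[C]_n -> 'M[C]_n) : Prop :=
  positive_map f /\
  ~ exists g h : 'End('M[C]_n),
      [/\ positive_map g, positive_map h, free [:: g; h]
        & forall Z, f Z = g Z + h Z].

Definition mx3 (C : nmodType) (rows : seq (seq C)) : 'M[C]_3 :=
  \matrix_(i < 3, j < 3) (nth [::] rows i)`_j.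

(* The indices of [Z] are numerals of the ring ['I_3], so [2] is the last index. *)

Definition Phi1 (R : realType) (t : R) (Z : 'M[R[i]]_3) : 'M[R[i]]_3 :=
  let d := ((t ^+ 2 - 1) ^+ 2)%:C in
  let e := (t ^+ 4 - t ^+ 2 + 1)%:C in
  let t4 := (t ^+ 4)%:C in
  mx3 [:: [:: d * Z 0 0 + Z 1 1 + t4 * Z 2 2; - (e * Z 0 1); - (e * Z 0 2)];
          [:: - (e * Z 1 0); t4 * Z 0 0 + d * Z 1 1 + Z 2 2; - (e * Z 1 2)];
          [:: - (e * Z 2 0); - (e * Z 2 1); Z 0 0 + t4 * Z 1 1 + d * Z 2 2]].

Definition Phi2 (R : realType) (p q : R) (Z : 'M[R[i]]_3) : 'M[R[i]]_3 :=
  let w00 := (p ^+ 2 * (p * q - 1) ^+ 2)%:C * Z 0 0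
           + (q * (2 * p - q))%:C * Z 1 1 in
  let w11 := (p ^+ 2 * q ^+ 3 * (2 * p - q))%:C * Z 0 0
           + (q ^+ 2 * (p * q - 1) ^+ 2)%:C * Z 1 1
           + (q * (2 * p - q))%:C * Z 2 2 in
  let w22 := (q * (2 * p - q) * (1 - p ^+ 2 * q ^+ 2))%:C * Z 0 0
           + (p ^+ 2 * q ^+ 3 * (2 * p - q))%:C * Z 1 1
           + (p ^+ 2 * (p * q - 1) ^+ 2)%:C * Z 2 2 in
  let k := (- (p * q * (1 - q ^+ 2 + p ^+ 2 * q ^+ 2)))%:C in
  let l := ((p * q - 1)
            * (p ^+ 2 + p * q - p ^+ 3 * q - q ^+ 2 + p ^+ 2 * q ^+ 2))%:C in
  mx3 [:: [:: w00;       k * Z 0 1; l * Z 0 2];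
          [:: k * Z 1 0; w11;       k * Z 1 2];
          [:: l * Z 2 0; k * Z 2 1; w22      ]].

Definition Phi3 (R : realType) (m n b c : R) (Z : 'M[R[i]]_3)
    : 'M[R[i]]_3 :=
  let m' := m%:C in
  let n' := n%:C in
  let u00 := n' ^+ 2 * (Z 0 0 + m' * (Z 0 1 + Z 1 0) + m' ^+ 2 * Z 1 1) in
  let u01 := - (m' * n')
             * (n' * Z 0 0 - Z 0 1 + m' * n' * Z 1 0 - m' * Z 1 1) in
  let u02 := - n' * (m' + n') * (Z 0 2 + m' * Z 1 2) in
  let u10 := - (m' * n')
             * (n' * Z 0 0 - Z 1 0 + m' * n' * Z 0 1 - m' * Z 1 1) in
  let u11 := m' ^+ 2 * (n' ^+ 2 * Z 0 0 - n' * (Z 0 1 + Z 1 0) + Z 1 1) in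
  let u12 := m' * (m' + n') * (n' * Z 0 2 - Z 1 2) in
  let u20 := - n' * (m' + n') * (Z 2 0 + m' * Z 2 1) in
  let u21 := m' * (m' + n') * (n' * Z 2 0 - Z 2 1) in
  let u22 := (m' + n') ^+ 2 * Z 2 2 in
  b%:C *: mx3 [:: [:: Z 1 1;     0;         - Z 0 2      ];
                  [:: 0;         Z 2 2;     - Z 1 2      ];
                  [:: - Z 2 0;   - Z 2 1;   Z 0 0 + Z 2 2]]
  + c%:C *: mx3 [:: [:: 0;             Z 0 1 - Z 1 0; 0];
                    [:: Z 1 0 - Z 0 1; 0;             0];
                    [:: 0;             0;             0]]
  + mx3 [:: [:: u00; u01; u02];
            [:: u10; u11; u12];
            [:: u20; u21; u22]].

(* Main.v *)
Require Import Defs.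
From HB Require Import structures.
From mathcomp Require Import all_boot all_order all_algebra.
From mathcomp Require Import reals.
From mathcomp Require Import complex.
From mathcomp Require Import ring lra.
Import Order.TTheory GRing.Theory Num.Theory.
Local Open Scope ring_scope.
Local Open Scope sesquilinear_scope.

(** A linear map f on matrices is studied through the form
F(x, y) = y^H f(x x^H) y, biquadratic in two complex vectors, whose tensor is
G i j k l = f(E_kl)_ij.  By the spectral theorem f is positive if and only if
F is nonnegative ([positive_map_biform]).

Extremality is read off the zeros of F.  If f = g + h with g and h positive,
then 0 <= F_g <= F_f, so F_g vanishes where F_f does, and it is O(t^4) on each
line where F_f is.  At a zero (x, y) of a nonnegative form the vector y is in
the kernel of the positive semidefinite matrix g(x x^H), and by
Cauchy-Schwarz the rows of that matrix, applied to y, are O(t^2) along a line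
of quartic contact ([flat_row]).  These are linear equations on the tensor of
g; exchanging x and y and conjugating gives four versions of each.  If they
determine a tensor up to one scalar, g is a multiple of f
([extremal_of_flat]).  What remains for each family is to find enough zeros,
to solve the linear system and to prove positivity.

The maps of the first two families commute with conjugation by diagonal
unitary matrices.  Their forms vanish at x = y = (1, w1, w2) for unimodular
w1, w2, and at pairs of vectors supported on two coordinates with a free
relative phase.  Comparing coefficients of Laurent polynomials in the phases
turns the row equations into small systems ([unique_cyclic],
[unique_acyclic]).  For t = 0 in the first family the zeros on two
coordinates degenerate to pairs of basis vectors, and quartic contact
supplies the lost equations ([flat_edge0]).  In the third family put
M = max(|m|, |n|) and r = sqrt(1 - M^2).  The hypothesis b >= 0 forces
m n < 0, and then b = r^2 - (1 + m n)^2 and 2 c = m n (r - (1 + m n)).  The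
zeros are x = y = (1, 1, w) and (1, -1, w), four more, and a line of
quartic contact through one of these ([Phi3_curve]); for r != 0 they suffice
([mixed_unique]).  If r = 0, then b = c = 0 and the map is Z |-> V Z V^H with
V of rank one, whose zeros are plentiful ([Phi3_extremal_rank1]).

For positivity fix x.  The matrix f(x x^H) has size three, so the signs of a
few minors decide ([herm3P]).  In the first two families the minors are
polynomials in the squared moduli of the entries of x, and the determinants
become sums of nonnegative terms once the smallest modulus is subtracted from
the other two ([det_cyc_min], [acyc_cubic_min2] and its companions).  In the
third family the real part of x 0 times the conjugate of x 1 enters as well;
the determinant is a positive multiple of [mixed_cubic], which is a square
plus two nonnegative terms after the choice of a suitable root of a quadratic
equation ([mixed_cubicE]). *)

Set Implicit Arguments.
Unset Strict Implicit.
Unset Printing Implicit Defensive.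

(** * Maps on matrices as biquadratic forms *)

Section BiForm.
Variables (C : numClosedFieldType) (n : nat).
Implicit Types (x y z : 'I_n -> C).

Definition tensor := 'I_n -> 'I_n -> 'I_n -> 'I_n -> C.
Implicit Types (G : tensor) (f : 'M[C]_n -> 'M[C]_n).

Definition sform G y y' x x' :=
  \sum_i \sum_j \sum_k \sum_l G i j k l * ((y i)^* * y' j * (x k * (x' l)^*)).

Definition biform G x y := sform G y y x x.

Definition tens f : tensor := fun i j k l => f (delta_mx k l) i j.

Definition rk1 x : 'M[C]_n := \matrix_(k, l) (x k * (x l)^*).

Definition qform (A : 'M[C]_n) y := \sum_i \sum_j (y i)^* * A i j * y j.

Lemma qformE (A : 'M[C]_n) (v : 'cV[C]_n) :
  (v ^t* *m A *m v) 0 0 = qform A (fun i => v i 0).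
Proof.
rewrite mxE /qform exchange_big /=; apply: eq_bigr => j _.
rewrite mxE mulr_suml; apply: eq_bigr => i _.
by rewrite !mxE.
Qed.

Lemma psdmxP (A : 'M[C]_n) :
  psdmx A <-> (forall i j, A i j = (A j i)^*) /\ (forall y, 0 <= qform A y).
Proof.
split=> [[/is_hermitianmxP hA pA]|[hA pA]].
  split=> [i j|y].
    by rewrite {1}hA expr0 scale1r !mxE.
  have := pA (\col_i y i); rewrite qformE.
  by under [X in 0 <= X -> _]eq_bigr do under eq_bigr do rewrite !mxE.
split=> [|v]; last by rewrite qformE.
apply/is_hermitianmxP/matrixP => i j.
by rewrite expr0 scale1r !mxE.
Qed.

Lemma linear_delta f (fL : linear f) A i j :
  f A i j = \sum_k \sum_l tens f i j k l * A k l.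
Proof.
have [f' ff'] : exists f' : {linear 'M[C]_n -> 'M[C]_n}, f =1 f'.
  pose g : {linear 'M[C]_n -> 'M[C]_n} :=
    HB.pack f (GRing.isLinear.Build _ _ _ _ f fL).
  by exists g.
rewrite ff' {1}[A]matrix_sum_delta linear_sum summxE; apply: eq_bigr => k _.
rewrite linear_sum summxE; apply: eq_bigr => l _.
by rewrite linearZ mxE /tens ff' mulrC.
Qed.

Lemma biform_tens f (fL : linear f) x y :
  biform (tens f) x y = qform (f (rk1 x)) y.
Proof.
rewrite /biform /sform /qform; apply: eq_bigr => i _; apply: eq_bigr => j _.
rewrite (linear_delta fL) mulr_sumr mulr_suml; apply: eq_bigr => k _.
rewrite mulr_sumr mulr_suml; apply: eq_bigr => l _.
rewrite mxE; ring.
Qed.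

Lemma deltaE (F : 'I_n -> C) (a : 'I_n) :
  \sum_i F i * (i == a)%:R = F a.
Proof.
rewrite (bigD1 a) //= eqxx mulr1 big1 ?addr0 // => i /negPf ->.
by rewrite mulr0.
Qed.

(** Polarization: the values at e_i + c e_j for c = 1, -1, 'i and - 'i determine
    the entries (i, j) and (j, i). *)
Lemma qform_herm (A : 'M[C]_n) :
  (forall y, qform A y \is Num.real) -> forall i j, A i j = (A j i)^*.
Proof.
move=> Ar i j.
pose y c (k : 'I_n) : C := (k == i)%:R + c * (k == j)%:R.
have E c : qform A (y c) = A i i + c * A i j + c^* * A j i + c^* * c * A j j.
  rewrite /qform /y.
  transitivity (\sum_k (A k i + c * A k j) * ((k == i)%:R + c^* * (k == j)%:R)).
    apply: eq_bigr => k _.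
    rewrite mulrDl -[in RHS](deltaE (fun l => A k l) i).
    rewrite -[in RHS](deltaE (fun l => A k l) j) mulr_sumr !mulr_suml -big_split.
    apply: eq_bigr => l _ /=.
    rewrite rmorphD rmorphM /= !rmorph_nat; ring.
  under eq_bigr do rewrite mulrDr mulrCA.
  by rewrite big_split /= -mulr_sumr !deltaE; ring.
have real_i : A i i \is Num.real.
  by have := Ar (y 0); rewrite E conjC0 !mul0r !addr0.
have half_real (a : C) : 2 * a \is Num.real -> a \is Num.real.
  by move=> ar; rewrite -[a](mulKf (_ : 2 != 0)) ?pnatr_eq0 // realM ?realV ?realn.
have sym : A i j + A j i \is Num.real /\ 'i * (A i j - A j i) \is Num.real.
  have R1 := Ar (y 1); have R2 := Ar (y (-1)); have R3 := Ar (y 'i).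
  have R4 := Ar (y (- 'i)); move: R1 R2 R3 R4.
  rewrite !E !rmorphN /= !rmorph1 !conjCi => R1 R2 R3 R4.
  split.
    have := rpredB R1 R2.
    rewrite (_ : _ - _ = 2 * (A i j + A j i)); last by ring.
    exact: half_real.
  have := rpredB R3 R4.
  rewrite (_ : _ - _ = 2 * ('i * (A i j - A j i))); last by ring.
  exact: half_real.
case: sym => /CrealP; rewrite rmorphD /= => S1 /CrealP; rewrite rmorphM rmorphB /= conjCi.
rewrite mulNr => S2.
have {}S2 : (A i j)^* - (A j i)^* = A j i - A i j.
  apply: (mulfI (neq0Ci C)); rewrite -[LHS]opprK S2; ring.
apply: (mulfI (_ : 2 != 0 :> C)); first by rewrite pnatr_eq0.
rewrite (_ : 2 * (A j i)^* = (A i j)^* + (A j i)^* - ((A i j)^* - (A j i)^*)).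
  by rewrite S1 S2; ring.
by ring.
Qed.

(** Both A and 'i A are hermitian by [qform_herm], which leaves only A = 0. *)
Lemma qform_eq0 (A : 'M[C]_n) : (forall y, qform A y = 0) -> A = 0.
Proof.
move=> A0; have h1 := qform_herm (fun y => eq_ind_r (fun c : C => c \is Num.real) (real0 C) (A0 y)).
have A0' y : qform ('i *: A) y \is Num.real.
  suff -> : qform ('i *: A) y = 'i * qform A y by rewrite A0 mulr0 real0.
  rewrite /qform mulr_sumr; apply: eq_bigr => i _; rewrite mulr_sumr.
  by apply: eq_bigr => j _; rewrite mxE; ring.
have h2 := qform_herm A0'.
apply/matrixP => i j; have := h2 i j; rewrite !mxE rmorphM /= conjCi mulNr -h1 => /eqP.
by rewrite -addr_eq0 -mulr2n mulrn_eq0 /= mulf_eq0 (negPf (neq0Ci C)) /= => /eqP.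
Qed.

Lemma psdmx_qform (A : 'M[C]_n) : psdmx A <-> forall y, 0 <= qform A y.
Proof.
split=> [/psdmxP[]|] // pA; apply/psdmxP; split=> //.
by apply: qform_herm => y; rewrite ger0_real.
Qed.

(** The vectors are the eigenvectors of a unitary diagonalization, scaled by the
    square roots of the eigenvalues. *)
Lemma psdmx_sum_rk1 (Z : 'M[C]_n) : psdmx Z ->
  exists x : 'I_n -> 'I_n -> C, Z = \sum_m rk1 (x m).
Proof.
move=> pZ; have [hZ _] := pZ; have [_ qZ] := (psdmxP Z).1 pZ.
have /orthomx_spectralP/= := hermitian_normalmx hZ.
set P := spectralmx Z; set d := spectral_diag Z => ZE.
have Pu : P \is unitarymx by exact: spectral_unitarymx.
have PV := invmx_unitary Pu.
have dE m : d 0 m = qform Z (fun i => (P m i)^*).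
  have : (P *m Z *m P^t*) m m = d 0 m.
    rewrite {1}ZE PV !mulmxA (unitarymxP Pu) mul1mx -mulmxA (unitarymxP Pu).
    by rewrite mulmx1 mxE eqxx mulr1n.
  move=> <-; rewrite mxE /qform exchange_big /=; apply: eq_bigr => j _.
  rewrite mxE mulr_suml; apply: eq_bigr => i _.
  by rewrite !mxE conjCK.
have d_ge0 m : 0 <= d 0 m by rewrite dE.
exists (fun m k => sqrtC (d 0 m) * (P m k)^*).
apply/matrixP => i j; rewrite {1}ZE PV summxE -mulmxA mxE.
apply: eq_bigr => m _; rewrite !mxE (bigD1 m) //= big1 ?addr0; last first.
  by move=> l lm; rewrite mxE eq_sym (negPf lm) mulr0n mul0r.
have sq_real : (sqrtC (d 0 m))^* = sqrtC (d 0 m).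
  by apply: conj_Creal; apply: ger0_real; rewrite sqrtC_ge0.
rewrite mxE eqxx mulr1n rmorphM /= conjCK sq_real -{1}(sqrtCK (d 0 m)).
by ring.
Qed.

Lemma qform_sum (m : nat) (A : 'I_m -> 'M[C]_n) y :
  qform (\sum_k A k) y = \sum_k qform (A k) y.
Proof.
rewrite /qform [RHS]exchange_big /=; apply: eq_bigr => i _.
rewrite [RHS]exchange_big /=; apply: eq_bigr => j _.
by rewrite summxE mulr_sumr mulr_suml.
Qed.

(** By [psdmx_sum_rk1] positivity need only be tested on the matrices [rk1 x]. *)
Lemma positive_map_biform f : linear f ->
  positive_map f <-> (forall x y, 0 <= biform (tens f) x y).
Proof.
move=> fL; split=> [[_ fp] x y|fp].
  rewrite biform_tens //; move: y; apply/psdmx_qform/fp/psdmx_qform => y.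
  have -> : qform (rk1 x) y = (\sum_i (y i)^* * x i) * (\sum_i (y i)^* * x i)^*.
    rewrite /qform rmorph_sum mulr_suml; apply: eq_bigr => i _.
    rewrite mulr_sumr; apply: eq_bigr => j _.
    by rewrite mxE rmorphM /= conjCK; ring.
  exact: mul_conjC_ge0.
split=> // Z /psdmx_sum_rk1[x ->]; apply/psdmx_qform => y.
have [f' ff'] : exists f' : {linear 'M[C]_n -> 'M[C]_n}, f =1 f'.
  pose g : {linear 'M[C]_n -> 'M[C]_n} :=
    HB.pack f (GRing.isLinear.Build _ _ _ _ f fL).
  by exists g.
rewrite ff' linear_sum qform_sum; apply: sumr_ge0 => m _.
by rewrite -ff' -biform_tens.
Qed.

End BiForm.

(** * Zeros of nonnegative forms *)

Section Flat.
Variables (C : numClosedFieldType) (n : nat).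
Implicit Types (x y z : 'I_n -> C) (G : tensor C n).

Definition conjv x : 'I_n -> C := fun i => (x i)^*.
Definition swapT G : tensor C n := fun i j k l => G k l i j.
Definition conjT G : tensor C n := fun i j k l => G j i l k.

Lemma sum_swap4 (F : 'I_n -> 'I_n -> 'I_n -> 'I_n -> C) :
  \sum_i \sum_j \sum_k \sum_l F i j k l = \sum_k \sum_l \sum_i \sum_j F i j k l.
Proof.
transitivity (\sum_i \sum_k \sum_l \sum_j F i j k l).
  apply: eq_bigr => i _; rewrite exchange_big; apply: eq_bigr => k _.
  by rewrite exchange_big.
rewrite exchange_big; apply: eq_bigr => k _.
by rewrite exchange_big.
Qed.

Lemma biform_swapT G x y : biform (swapT G) x y = biform G (conjv y) (conjv x).
Proof.
rewrite /biform /sform sum_swap4; do 4 (apply: eq_bigr => ? _).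
by rewrite /swapT /conjv !conjCK; ring.
Qed.

Lemma biform_conjT G x y : biform (conjT G) x y = biform G (conjv x) (conjv y).
Proof.
rewrite /biform /sform exchange_big; do 2 (apply: eq_bigr => ? _).
rewrite exchange_big; do 2 (apply: eq_bigr => ? _).
by rewrite /conjT /conjv !conjCK; ring.
Qed.

(** Cauchy-Schwarz for the form A between y and the basis vector e_i, obtained
    from the point y + c e_i.  Choosing c with a strict upper bound M of A i i in
    place of A i i avoids dividing by an entry that may vanish. *)
Lemma qform_le_row (A : 'M[C]_n) y i (M : C) :
  (forall z, 0 <= qform A z) -> 0 < M -> A i i <= M ->
  `|\sum_j A i j * y j| ^+ 2 <= M * qform A y.
Proof.
move=> pA M_gt0 AM; set a := \sum_j _.
have hA := qform_herm (fun z => ger0_real (pA z)).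
(* the minimizer over c of the form at y + c e_i, if A i i were equal to M *)
pose c := - (a / M).
have Mr : M^* = M by apply: conj_Creal; apply: gtr0_real.
have := pA (fun k => y k + c * (k == i)%:R).
have -> : qform A (fun k => y k + c * (k == i)%:R) =
    qform A y + c^* * a + c * a^* + c^* * c * A i i.
  rewrite /qform.
  transitivity (\sum_k \sum_l ((y k)^* * A k l * y l
     + (k == i)%:R * (c^* * (A k l * y l))
     + (c * ((y k)^* * A k l)) * (l == i)%:R
     + c * c^* * A k l * (l == i)%:R * (k == i)%:R)).
    apply: eq_bigr => k _; apply: eq_bigr => l _.
    by rewrite rmorphD rmorphM /= rmorph_nat; ring.
  under eq_bigr do rewrite !big_split /= -mulr_sumr -mulr_suml !deltaE mulrC.
  rewrite !big_split /= !deltaE -!mulr_sumr -/a.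
  suff -> : \sum_k (y k)^* * A k i = a^* by ring.
  rewrite /a rmorph_sum; apply: eq_bigr => k _.
  by rewrite rmorphM /= -hA mulrC.
have cE : c^* = - (a^* / M) by rewrite rmorphN fmorph_div /= Mr.
rewrite cE /c normCK => le0.
have le1 : 0 <= qform A y - a * a^* / M.
  apply: le_trans le0 _; rewrite -subr_ge0.
  rewrite (_ : _ - _ = (M - A i i) * (a * a^* / M ^+ 2)); last first.
    by field; rewrite gt_eqF.
  by rewrite mulr_ge0 ?subr_ge0 // divr_ge0 ?mul_conjC_ge0 ?exprn_ge0 ?ltW.
by move: le1; rewrite subr_ge0 ler_pdivrMr // [_ * M]mulrC.
Qed.

(** The shape is that of a row sum of a biquadratic form along a line: it has
    degree 1 in y and bidegree (1, 1) in x. *)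
Lemma poly3_small (K a0 a1 a2 a3 : C) :
  (forall t, 0 < t <= 1 ->
     `|a0 + a1 * t + a2 * t ^+ 2 + a3 * t ^+ 3| ^+ 2 <= K * t ^+ 4) ->
  a0 = 0 /\ a1 = 0.
Proof.
move=> H; have K_ge0 : 0 <= K.
  have := H 1; rewrite ltr01 lexx => /(_ isT).
  by rewrite !expr1n !mulr1; apply: le_trans; rewrite exprn_ge0.
have small (c a : C) : 0 <= c ->
    (forall t, 0 < t <= 1 -> `|a| <= c * t) -> a = 0.
  move=> c_ge0 Ha; have [//|] := eqVneq a 0; rewrite -normr_gt0 => a_gt0.
  have d_gt0 : 0 < `|a| + (c + 1) by rewrite ltr_pwDl ?addr_ge0.
  have := Ha (`|a| / (`|a| + (c + 1))).
  rewrite divr_gt0 // ler_pdivrMr // mul1r lerDl addr_ge0 ?ler01 //.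
  move=> /(_ isT); rewrite mulrA ler_pdivlMr // mulrC -subr_ge0.
  rewrite (_ : _ - _ = - (`|a| * (`|a| + 1))); last by ring.
  by rewrite oppr_ge0 lt_geF // mulr_gt0 // ltr_wpDl.
have S_ge0 : 0 <= sqrtC K by rewrite sqrtC_ge0.
have H1 t : 0 < t <= 1 -> `|a0 + a1 * t| <= (sqrtC K + `|a2| + `|a3|) * t ^+ 2.
  move=> /[dup] t01 /andP[t_gt0 t_le1].
  have -> : a0 + a1 * t = (a0 + a1 * t + a2 * t ^+ 2 + a3 * t ^+ 3)
    - a2 * t ^+ 2 - a3 * t ^+ 3 by ring.
  rewrite !mulrDl; apply: le_trans (ler_normB _ _) _; apply: lerD.
    apply: le_trans (ler_normB _ _) _; apply: lerD.
      rewrite -(ler_pXn2r (ltn0Sn 1)) ?nnegrE ?normr_ge0 //.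
        by rewrite exprMn sqrtCK -exprM H.
      by rewrite mulr_ge0 ?exprn_ge0 // ltW.
    by rewrite normrM normrX (gtr0_norm t_gt0).
  rewrite normrM normrX (gtr0_norm t_gt0) ler_wpM2l ?normr_ge0 //.
  by rewrite exprS ler_piMl // exprn_ge0 // ltW.
have a00 : a0 = 0.
  apply: (small (sqrtC K + `|a2| + `|a3| + `|a1|)).
    by rewrite !addr_ge0.
  move=> t /[dup] t01 /andP[t_gt0 t_le1].
  rewrite -[a0](addrK (a1 * t)); apply: le_trans (ler_normB _ _) _.
  rewrite [X in _ <= X]mulrDl; apply: lerD; last by rewrite normrM (gtr0_norm t_gt0).
  apply: le_trans (H1 _ t01) _; rewrite ler_wpM2l ?addr_ge0 //.
  by rewrite expr2 ler_piMl // ltW.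
split=> //; apply: (small (sqrtC K + `|a2| + `|a3|)); first by rewrite !addr_ge0.
move=> t /[dup] t01 /andP[t_gt0 t_le1]; have := H1 _ t01.
by rewrite a00 add0r normrM (gtr0_norm t_gt0) expr2 mulrA ler_pM2r.
Qed.

Definition rowsum G i y x x' :=
  \sum_j \sum_k \sum_l G i j k l * (y j * (x k * (x' l)^*)).

Definition line x x' (t : C) : 'I_n -> C := fun i => x i + t * x' i.

Lemma rowsumDy G i y y' x x' t :
  rowsum G i (line y y' t) x x' = rowsum G i y x x' + t * rowsum G i y' x x'.
Proof.
rewrite /rowsum mulr_sumr -big_split; apply: eq_bigr => j _ /=.
rewrite mulr_sumr -big_split; apply: eq_bigr => k _ /=.
rewrite mulr_sumr -big_split; apply: eq_bigr => l _ /=.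
by rewrite /line; ring.
Qed.

Lemma rowsumDx G i y x x1 x' t :
  rowsum G i y (line x x1 t) x' = rowsum G i y x x' + t * rowsum G i y x1 x'.
Proof.
rewrite /rowsum mulr_sumr -big_split; apply: eq_bigr => j _ /=.
rewrite mulr_sumr -big_split; apply: eq_bigr => k _ /=.
rewrite mulr_sumr -big_split; apply: eq_bigr => l _ /=.
by rewrite /line; ring.
Qed.

Lemma rowsumDx' G i y x x' x1 t : t^* = t ->
  rowsum G i y x (line x' x1 t) = rowsum G i y x x' + t * rowsum G i y x x1.
Proof.
move=> tr; rewrite /rowsum mulr_sumr -big_split; apply: eq_bigr => j _ /=.
rewrite mulr_sumr -big_split; apply: eq_bigr => k _ /=.
rewrite mulr_sumr -big_split; apply: eq_bigr => l _ /=.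
by rewrite /line rmorphD rmorphM /= tr; ring.
Qed.

Lemma eq_rowsum G i y y' x x' z z' : y =1 y' -> x =1 x' -> z =1 z' ->
  rowsum G i y x z = rowsum G i y' x' z'.
Proof.
move=> yy xx zz; rewrite /rowsum; do 3 (apply: eq_bigr => ? _).
by rewrite yy xx zz.
Qed.

(** The Taylor coefficients of degree 0 and 1 at t = 0 of the row sums along the
    lines x0 + t x1 and y0 + t y1. *)
Definition flat G x0 x1 y0 y1 := forall i,
  rowsum G i y0 x0 x0 = 0 /\
  rowsum G i y1 x0 x0 + rowsum G i y0 x1 x0 + rowsum G i y0 x0 x1 = 0.

Lemma eq_flat G x0 x0' x1 x1' y0 y0' y1 y1' :
  x0 =1 x0' -> x1 =1 x1' -> y0 =1 y0' -> y1 =1 y1' ->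
  flat G x0 x1 y0 y1 -> flat G x0' x1' y0' y1'.
Proof.
move=> e0 e1 e2 e3 f i; have [f1 f2] := f i; split.
  by rewrite -(eq_rowsum G i e2 e0 e0).
by rewrite -(eq_rowsum G i e3 e0 e0) -(eq_rowsum G i e2 e1 e0) -(eq_rowsum G i e2 e0 e1).
Qed.

(** A row sum is bounded by the square root of the form ([qform_le_row]), so it
    is O(t^2) where the form is O(t^4). *)
Lemma flat_row G x0 x1 y0 y1 K : (forall x y, 0 <= biform G x y) ->
  (forall t, 0 < t <= 1 ->
     biform G (line x0 x1 t) (line y0 y1 t) <= K * t ^+ 4) ->
  flat G x0 x1 y0 y1.
Proof.
move=> pG HK i.
pose H x : 'M[C]_n := \matrix_(a, b) \sum_k \sum_l G a b k l * (x k * (x l)^*).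
have HE x y : qform (H x) y = biform G x y.
  rewrite /qform /biform /sform; apply: eq_bigr => a _; apply: eq_bigr => b _.
  rewrite mxE mulr_sumr mulr_suml; apply: eq_bigr => k _.
  by rewrite mulr_sumr mulr_suml; apply: eq_bigr => l _; ring.
have rowE x y : \sum_b H x i b * y b = rowsum G i y x x.
  rewrite /rowsum; apply: eq_bigr => b _.
  rewrite mxE mulr_suml; apply: eq_bigr => k _.
  by rewrite mulr_suml; apply: eq_bigr => l _; ring.
(* a bound on the diagonal entry i along the line, uniform for t <= 1 *)
pose M := 1 + \sum_k \sum_l `|G i i k l| * ((`|x0 k| + `|x1 k|) * (`|x0 l| + `|x1 l|)).
have M_gt0 : 0 < M.
  rewrite ltr_wpDr // sumr_ge0 // => k _; rewrite sumr_ge0 // => l _.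
  by rewrite !mulr_ge0 ?addr_ge0.
have bound t : 0 < t <= 1 -> H (line x0 x1 t) i i <= M.
  move=> /andP[t_gt0 t_le1].
  have lineN k : `|line x0 x1 t k| <= `|x0 k| + `|x1 k|.
    apply: le_trans (ler_normD _ _) _; rewrite lerD2l normrM gtr0_norm //.
    by rewrite ler_piMl.
  have Hii_ge0 : 0 <= H (line x0 x1 t) i i.
    have := pG (line x0 x1 t) (fun k => (k == i)%:R); rewrite -HE /qform.
    under eq_bigr do rewrite deltaE rmorph_nat mulrC.
    by rewrite deltaE.
  rewrite -(ger0_norm Hii_ge0) mxE; apply: le_trans (ler_norm_sum _ _ _) _.
  apply: ler_wpDl => //; apply: ler_sum => k _.
  apply: le_trans (ler_norm_sum _ _ _) _; apply: ler_sum => l _.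
  rewrite !normrM norm_conjC; apply: ler_wpM2l => //.
  by apply: ler_pM.
have := @poly3_small (M * K)
  (rowsum G i y0 x0 x0)
  (rowsum G i y1 x0 x0 + rowsum G i y0 x1 x0 + rowsum G i y0 x0 x1)
  (rowsum G i y1 x1 x0 + rowsum G i y1 x0 x1 + rowsum G i y0 x1 x1)
  (rowsum G i y1 x1 x1).
apply=> t /[dup] t01 /andP[t_gt0 _].
have tr : t^* = t by apply: conj_Creal; apply: gtr0_real.
have := @qform_le_row (H (line x0 x1 t)) (line y0 y1 t) i M.
rewrite rowE HE => /(_ _ M_gt0 (bound _ t01)) le1.
have {}le1 := le1 (fun z => eq_ind_r (fun u => 0 <= u) (pG _ z) (HE _ z)).
set lhs := (X in `|X|).
have -> : lhs = rowsum G i (line y0 y1 t) (line x0 x1 t) (line x0 x1 t).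
  by rewrite /lhs rowsumDy !rowsumDx !rowsumDx' //; ring.
apply: le_trans le1 _; rewrite -mulrA ler_pM2l //; exact: HK.
Qed.
(** A vector y that forms a zero with every x annihilates each slice of the
    tensor, by polarization in x. *)
Lemma rowsum_eq0 (G : tensor C n) y : (forall x i, rowsum G i y x x = 0) ->
  forall i k l, \sum_j G i j k l * y j = 0.
Proof.
move=> H i k l; pose A : 'M[C]_n := \matrix_(l, k) \sum_j G i j k l * y j.
suff : A = 0 by move=> /matrixP/(_ l k); rewrite !mxE.
apply: qform_eq0 => x; rewrite -[RHS](H x i) /qform /rowsum exchange_big.
rewrite [RHS]exchange_big; apply: eq_bigr => k' _ /=.
rewrite [RHS]exchange_big; apply: eq_bigr => l' _ /=.
by rewrite mxE mulr_sumr mulr_suml; apply: eq_bigr => j _; ring.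
Qed.

End Flat.

(** * A criterion for extremality *)

Section Extremal.
Variables (C : numClosedFieldType) (n : nat).
Implicit Types (x y z : 'I_n -> C) (G : tensor C n) (f : 'M[C]_n -> 'M[C]_n).

(** [flat] for the four tensors that represent the same form up to exchanging
    and conjugating its arguments; each of them is nonnegative when G is. *)
Definition flat4 G x0 x1 y0 y1 :=
  [/\ flat G x0 x1 y0 y1,
      flat (conjT G) (conjv x0) (conjv x1) (conjv y0) (conjv y1),
      flat (swapT G) (conjv y0) (conjv y1) (conjv x0) (conjv x1)
    & flat (conjT (swapT G)) y0 y1 x0 x1].

Lemma flatD G G' a x0 x1 y0 y1 :
  flat G x0 x1 y0 y1 -> flat G' x0 x1 y0 y1 ->
  flat (fun i j k l => G i j k l - a * G' i j k l) x0 x1 y0 y1.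
Proof.
have E i y x x' : rowsum (fun i j k l => G i j k l - a * G' i j k l) i y x x' =
    rowsum G i y x x' - a * rowsum G' i y x x'.
  rewrite /rowsum mulr_sumr -sumrB; apply: eq_bigr => j _ /=.
  rewrite mulr_sumr -sumrB; apply: eq_bigr => k _ /=.
  by rewrite mulr_sumr -sumrB; apply: eq_bigr => l _ /=; ring.
move=> H H' i; have [H1 H2] := H i; have [H1' H2'] := H' i.
rewrite !E H1 H1' mulr0 subrr; split=> //.
rewrite (_ : _ + _ = rowsum G i y1 x0 x0 + rowsum G i y0 x1 x0 + rowsum G i y0 x0 x1
  - a * (rowsum G' i y1 x0 x0 + rowsum G' i y0 x1 x0 + rowsum G' i y0 x0 x1)).
  by rewrite H2 H2' mulr0 subrr.
by ring.
Qed.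

Lemma conjv_line x x' (t : C) : 0 < t ->
  conjv (line (conjv x) (conjv x') t) =1 line x x' t.
Proof.
move=> t_gt0 i; rewrite /conjv /line rmorphD rmorphM /= !conjCK.
by rewrite (conj_Creal (gtr0_real t_gt0)).
Qed.

Lemma eq_biform G x x' y y' : x =1 x' -> y =1 y' -> biform G x y = biform G x' y'.
Proof.
move=> xx yy; rewrite /biform /sform; do 4 (apply: eq_bigr => ? _).
by rewrite !xx !yy.
Qed.

Lemma conjvK x : conjv (conjv x) =1 x.
Proof. by move=> i; rewrite /conjv conjCK. Qed.

Lemma flat4_le G x0 x1 y0 y1 K : (forall x y, 0 <= biform G x y) ->
  (forall t, 0 < t <= 1 ->
     biform G (line x0 x1 t) (line y0 y1 t) <= K * t ^+ 4) ->
  flat4 G x0 x1 y0 y1.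
Proof.
move=> pG HK.
have pS x y : 0 <= biform (swapT G) x y by rewrite biform_swapT.
have pC x y : 0 <= biform (conjT G) x y by rewrite biform_conjT.
have pCS x y : 0 <= biform (conjT (swapT G)) x y by rewrite biform_conjT.
split; apply: (@flat_row _ _ _ _ _ _ _ K) => // t /[dup] t01 /andP[t_gt0 _].
- rewrite biform_conjT (@eq_biform _ _ (line x0 x1 t) _ (line y0 y1 t)).
  + exact: HK.
  + exact: conjv_line.
  + exact: conjv_line.
- rewrite biform_swapT (@eq_biform _ _ (line x0 x1 t) _ (line y0 y1 t)).
  + exact: HK.
  + exact: conjv_line.
  + exact: conjv_line.
- rewrite biform_conjT biform_swapT.
  rewrite (@eq_biform _ _ (line x0 x1 t) _ (line y0 y1 t)); first exact: HK.
    exact: conjvK.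
  exact: conjvK.
Qed.

(** Let f = g + h and let c be the quotient of the entries (a, b, k, l) of the
    tensors of g and f.  Both tensors satisfy the flatness relations of f, hence
    so does the tensor of g - c f, whose entry (a, b, k, l) is zero; the
    hypothesis gives g = c f, so g and h are dependent. *)
Lemma extremal_of_flat f a b k l :
  positive_map f -> tens f a b k l != 0 ->
  (forall G,
     (forall x0 x1 y0 y1 K,
        (forall t, 0 < t <= 1 ->
           biform (tens f) (line x0 x1 t) (line y0 y1 t) = K * t ^+ 4) ->
        flat4 G x0 x1 y0 y1) ->
     G a b k l = 0 -> forall i j k l, G i j k l = 0) ->
  extremal_positive_map f.
Proof.
move=> /[dup] pf [fL _] f_neq0 fG; split=> // -[g [h [pg ph gh fE]]].
have gL : linear g by move=> c A B; exact: linearP.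
have hL : linear h by move=> c A B; exact: linearP.
have bf := (positive_map_biform fL).1 pf.
have bg := (positive_map_biform gL).1 pg.
have bh := (positive_map_biform hL).1 ph.
have bfE x y : biform (tens f) x y = biform (tens g) x y + biform (tens h) x y.
  rewrite /biform /sform; do 4 (rewrite -big_split; apply: eq_bigr => ? _ /=).
  by rewrite /tens fE mxE mulrDl.
pose c := tens g a b k l / tens f a b k l.
have gE Z : g Z = c *: f Z.
  apply/matrixP => i j; rewrite mxE (linear_delta gL) (linear_delta fL) mulr_sumr.
  apply: eq_bigr => k' _; rewrite mulr_sumr; apply: eq_bigr => l' _.
  apply/eqP; rewrite -subr_eq0 mulrA -mulrBl; apply/eqP.
  rewrite (fG (fun i j k l => tens g i j k l - c * tens f i j k l)) ?mul0r //; last first.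
    by rewrite /c divfK ?subrr.
  move=> x0 x1 y0 y1 K HK.
  have [Hg Hg2 Hg3 Hg4] : flat4 (tens g) x0 x1 y0 y1.
    by apply: (@flat4_le _ _ _ _ _ K) => // t /HK <-; rewrite bfE lerDl.
  have [Hf Hf2 Hf3 Hf4] : flat4 (tens f) x0 x1 y0 y1.
    by apply: (@flat4_le _ _ _ _ _ K) => // t /HK <-.
  split; [exact: flatD Hg Hf|exact: flatD Hg2 Hf2|exact: flatD Hg3 Hf3|exact: flatD Hg4 Hf4].
have ghE : (1 - c) *: g = c *: h.
  apply/lfunP => Z; rewrite !scale_lfunE scalerBl scale1r.
  by apply/eqP; rewrite subr_eq -scalerDr addrC -fE; apply/eqP; exact: gE.
move: gh; have [c1|c1] := eqVneq c 1.
  move: ghE; rewrite c1 subrr scale0r scale1r => <-.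
  by rewrite free_cons seq1_free eqxx andbF.
rewrite free_cons => /andP[/negP + _]; apply.
rewrite span_seq1; apply/vlineP; exists (c / (1 - c)).
have c1' : 1 - c != 0 by rewrite subr_eq0 eq_sym.
by rewrite mulrC -scalerA -ghE scalerA mulVf // scale1r.
Qed.

End Extremal.

(** * Linear relations from zeros on tori *)

Lemma I3_ind (P : 'I_3 -> Prop) : P 0 -> P 1 -> P 2 -> forall i, P i.
Proof.
move=> P0 P1 P2 [[|[|[|//]]] Hi].
- by rewrite (_ : Ordinal Hi = 0) //; apply: val_inj.
- by rewrite (_ : Ordinal Hi = 1) //; apply: val_inj.
- by rewrite (_ : Ordinal Hi = 2) //; apply: val_inj.
Qed.

Lemma sum3 (V : nmodType) (F : 'I_3 -> V) : \sum_i F i = F 0 + F 1 + F 2.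
Proof.
rewrite !big_ord_recl big_ord0 addr0 addrA.
by congr (_ + F _ + F _); apply: val_inj.
Qed.

Lemma eq0D (R : nzRingType) (a b : R) : a = 0 -> b = 0 -> a + b = 0.
Proof. by move=> -> ->; rewrite addr0. Qed.

Lemma eq0M (R : nzRingType) (k a : R) : a = 0 -> k * a = 0.
Proof. by move=> ->; rewrite mulr0. Qed.

Notation "H +e H'" := (eq0D H H') (at level 50, left associativity).
Notation "k *e H" := (eq0M k H) (at level 40).

(** Here [H] is a linear combination of known equations of the form [e = 0],
    built with the two notations above; the goal [a = 0] then follows from the
    ring identity between [a] and the combination. *)
Ltac lincomb H := rewrite -[RHS]H; ring.

Section Torus.
Variable C : numClosedFieldType.
Implicit Types (x y z : 'I_3 -> C) (G : tensor C 3) (c : 'I_3 -> 'I_3 -> 'I_3 -> C).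

Definition vec3 (a b c : C) : 'I_3 -> C := fun i => [:: a; b; c]`_i.

Definition unim (w : C) := w * w^* = 1.

Lemma unimC w : unim w -> unim w^*.
Proof. by rewrite /unim conjCK mulrC. Qed.

(** The fourth roots of unity separate the exponents 0, 1, -1, 2. *)
Lemma laurent0 (a b c d : C) :
  (forall w, unim w -> a + b * w + c * w^* + d * w ^+ 2 = 0) ->
  [/\ a = 0, b = 0, c = 0 & d = 0].
Proof.
move=> H.
have H1 : a + b + c + d = 0.
  by rewrite -(H 1); [rewrite rmorph1; ring|rewrite /unim rmorph1 mulr1].
have H2 : a - b - c + d = 0.
  by rewrite -(H (-1)); [rewrite rmorphN rmorph1; ring|rewrite /unim rmorphN rmorph1; ring].
have i2 : 'i ^+ 2 = -1 :> C by exact: sqrCi.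
have H3 : a + b * 'i - c * 'i - d = 0.
  by rewrite -(H 'i); [rewrite conjCi; ring: i2|rewrite /unim conjCi; ring: i2].
have H4 : a - b * 'i + c * 'i - d = 0.
  by rewrite -(H (- 'i)); [rewrite rmorphN /= conjCi; ring: i2|rewrite /unim rmorphN /= conjCi; ring: i2].
have four : 4 != 0 :> C by rewrite pnatr_eq0.
split; apply: (mulfI four); rewrite mulr0.
- lincomb (H1 +e H2 +e H3 +e H4).
- rewrite -[RHS](H1 +e -1 *e H2 +e (- 'i) *e H3 +e 'i *e H4); ring: i2.
- rewrite -[RHS](H1 +e -1 *e H2 +e 'i *e H3 +e (- 'i) *e H4); ring: i2.
- lincomb (H1 +e H2 +e -1 *e H3 +e -1 *e H4).
Qed.

Definition trisum c u v w := \sum_j \sum_k \sum_l c j k l * (u j * (v k * (w l)^*)).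

(** The coefficients of w_a^2 / w_b and of w_a in [trisum c w w w], as a Laurent
    polynomial in phases w_0, w_1, w_2. *)
Definition monomials0 c :=
  (forall a b, a != b -> c a a b = 0) /\
  (forall a b d, uniq [:: a; b; d] ->
     c a a a + (c a b b + c b a b) + (c a d d + c d a d) = 0).

Lemma torus_monomials0 c :
  (forall w1 w2, unim w1 -> unim w2 ->
     trisum c (vec3 1 w1 w2) (vec3 1 w1 w2) (vec3 1 w1 w2) = 0) ->
  monomials0 c.
Proof.
move=> H.
have {}H w1 w2 : unim w1 -> unim w2 ->
  ((c 0 0 0 + c 0 1 1 + c 1 0 1 + c 0 2 2 + c 2 0 2)
   + (c 0 1 0 + c 1 0 0 + c 1 1 1 + c 1 2 2 + c 2 1 2) * w1
   + c 0 0 1 * w1^* + c 1 1 0 * w1 ^+ 2)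
  + ((c 2 0 0 + c 2 1 1 + c 0 2 0 + c 1 2 1 + c 2 2 2)
     + (c 2 1 0 + c 1 2 0) * w1 + (c 2 0 1 + c 0 2 1) * w1^* + 0 * w1 ^+ 2) * w2
  + (c 0 0 2 + (c 0 1 2 + c 1 0 2) * w1 + 0 * w1^* + c 1 1 2 * w1 ^+ 2) * w2^*
  + (c 2 2 0 + 0 * w1 + c 2 2 1 * w1^* + 0 * w1 ^+ 2) * w2 ^+ 2 = 0.
  move=> u1 u2; rewrite -[RHS](H _ _ u1 u2) /trisum !sum3 /vec3 /= rmorph1.
  by ring: u1 u2.
have {}H w1 (u1 : unim w1) := laurent0 (fun w2 u2 => H w1 w2 u1 u2).
have [A0 A1 A2 A3] := laurent0 (fun w u => let: And4 h _ _ _ := H w u in h).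
have [B0 _ _ _] := laurent0 (fun w u => let: And4 _ h _ _ := H w u in h).
have [C0 _ _ C3] := laurent0 (fun w u => let: And4 _ _ h _ := H w u in h).
have [D0 _ D2 _] := laurent0 (fun w u => let: And4 _ _ _ h := H w u in h).
split=> [a b|a b d].
  by elim/I3_ind: a; elim/I3_ind: b.
elim/I3_ind: a; elim/I3_ind: b; elim/I3_ind: d => // _.
- by lincomb A0.
- by lincomb A0.
- by lincomb A1.
- by lincomb A1.
- by lincomb B0.
- by lincomb B0.
Qed.

Lemma eq_trisum c u u' v v' w w' : u =1 u' -> v =1 v' -> w =1 w' ->
  trisum c u v w = trisum c u' v' w'.
Proof.
move=> uu vv ww; rewrite /trisum; do 3 (apply: eq_bigr => ? _).
by rewrite uu vv ww.
Qed.

Definition zv : 'I_3 -> C := fun=> 0.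

Lemma line_zv (x : 'I_3 -> C) (s : C) : line x zv s =1 x.
Proof. by move=> i; rewrite /line /zv mulr0 addr0. Qed.

Lemma flat_zero (F G : tensor C 3) x y :
  (forall x0 x1 y0 y1 K,
     (forall t : C, 0 < t <= 1 -> biform F (line x0 x1 t) (line y0 y1 t) = K * t ^+ 4) ->
     flat4 G x0 x1 y0 y1) ->
  biform F x y = 0 -> flat4 G x zv y zv.
Proof.
move=> H F0; apply: (H _ _ _ _ 0) => t _.
by rewrite (eq_biform _ (line_zv _ _) (line_zv _ _)) F0 mul0r.
Qed.

Definition each4 (P : tensor C 3 -> Prop) G :=
  [/\ P G, P (conjT G), P (swapT G) & P (conjT (swapT G))].

Lemma each4_conj (P : tensor C 3 -> Prop) G : each4 P G -> each4 P (conjT G).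
Proof. by case. Qed.

Definition diag_killed G := forall i, monomials0 (G i).

Lemma flat_ones G :
  (forall w1 w2, unim w1 -> unim w2 ->
     flat4 G (vec3 1 w1 w2) zv (vec3 1 w1 w2) zv) ->
  each4 diag_killed G.
Proof.
move=> H.
have cE w1 w2 : conjv (vec3 1 w1^* w2^*) =1 vec3 1 w1 w2.
  by elim/I3_ind; rewrite /conjv /vec3 /= ?rmorph1 ?conjCK.
split=> i; apply: torus_monomials0 => w1 w2 u1 u2.
- by have [/(_ i)[]] := H _ _ u1 u2.
- have [_ /(_ i)[+ _] _ _] := H _ _ (unimC u1) (unimC u2).
  by rewrite -[_ = 0 in X in X -> _]/(trisum _ _ _ _ = 0) !(eq_trisum _ (cE w1 w2) (cE w1 w2) (cE w1 w2)).
- have [_ _ /(_ i)[+ _] _] := H _ _ (unimC u1) (unimC u2).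
  by rewrite -[_ = 0 in X in X -> _]/(trisum _ _ _ _ = 0) !(eq_trisum _ (cE w1 w2) (cE w1 w2) (cE w1 w2)).
- by have [_ _ _ /(_ i)[]] := H _ _ u1 u2.
Qed.

Section Rules.
Variable G : tensor C 3.
Hypothesis G1 : each4 diag_killed G.

Let R1 i a b : a != b -> G i a a b = 0.
Proof. by move=> ab; case: G1 => /(_ i)[/(_ a b ab)]. Qed.
Let R2 i a b : a != b -> G a i b a = 0.
Proof. by move=> ab; case: G1 => _ /(_ i)[/(_ a b ab)]. Qed.
Let R3 i a b : a != b -> G a b i a = 0.
Proof. by move=> ab; case: G1 => _ _ /(_ i)[/(_ a b ab)]. Qed.
Let R4 i a b : a != b -> G b a a i = 0.
Proof. by move=> ab; case: G1 => _ _ _ /(_ i)[/(_ a b ab)]. Qed.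

Lemma row_diag a b d : uniq [:: a; b; d] ->
  G a a a a + (G a a b b + G a b a b) + (G a a d d + G a d a d) = 0.
Proof. by case: G1 => /(_ a)[_ /(_ a b d) H] _ _ _ /H. Qed.

Lemma col_diag a b d : uniq [:: a; b; d] ->
  G a a a a + (G b b a a + G a b a b) + (G d d a a + G a d a d) = 0.
Proof. by case: G1 => _ _ /(_ a)[_ /(_ a b d) H] _ /H. Qed.

Lemma off_row a b d : uniq [:: a; b; d] -> G d a b b + G d b a b = 0.
Proof.
move=> u; have := u; rewrite /= !inE negb_or !andbT => /andP[/andP[ab ad] bd].
case: G1 => /(_ d)[_ /(_ a b d u)] + _ _ _.
by rewrite R4 // R3 1?eq_sym // R2 1?eq_sym // !addr0 add0r.
Qed.

Lemma off_conj a b d : uniq [:: a; b; d] -> G a d b b + G b d b a = 0.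
Proof.
move=> u; have := u; rewrite /= !inE negb_or !andbT => /andP[/andP[ab ad] bd].
case: G1 => _ /(_ d)[_ /(_ a b d u)] + _ _; rewrite /conjT.
by rewrite R3 // R4 1?eq_sym // R1 1?eq_sym // !addr0 add0r.
Qed.

Lemma off_swap a b d : uniq [:: a; b; d] -> G b b d a + G a b d b = 0.
Proof.
move=> u; have := u; rewrite /= !inE negb_or !andbT => /andP[/andP[ab ad] bd].
case: G1 => _ _ /(_ d)[_ /(_ a b d u)] + _; rewrite /swapT.
by rewrite R2 // R1 1?eq_sym // R4 1?eq_sym // !addr0 add0r.
Qed.

(** The relations of the torus zeros kill every entry that is not of one of the
    three kinds in the hypotheses, or pair it with one of these. *)
Lemma torus_vanish :
  (forall a b, G a a b b = 0) ->
  (forall a b, a != b -> G a b a b = 0) ->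
  (forall a b d, uniq [:: a; b; d] -> G d a b b = 0) ->
  forall i j k l, G i j k l = 0.
Proof.
move=> A0 B0 U1.
have U2 a b d : uniq [:: a; b; d] -> G d b a b = 0.
  by move=> u; have := off_row u; rewrite U1 // add0r.
have U3 a b d : uniq [:: a; b; d] -> G b d b a = 0.
  move=> u; have := off_conj u; rewrite U1 ?add0r //.
  by rewrite -rev_uniq.
have U4 a b d : uniq [:: a; b; d] -> G b b d a = 0.
  move=> u; have := off_swap u; rewrite U2 ?addr0 //.
  by rewrite -rev_uniq.
elim/I3_ind; elim/I3_ind; elim/I3_ind; elim/I3_ind;
  first [exact: A0|exact: B0|exact: R1|exact: R2|exact: R3|exact: R4
        |exact: U1|exact: U2|exact: U3|exact: U4].
Qed.

End Rules.

(** The equations imposed on row i by zeros with both vectors supported on the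
    coordinates a and b, after separation of the phases. *)
Definition edge_eqs (a b : 'I_3) (p q r p' q' r' : C) G := forall i,
  p * G i a a a + q * G i a b b + r * G i b a b = 0 /\
  p' * G i b a a + q' * G i b b b + r' * G i a b a = 0.

(** On a row d outside of the edge one of the three terms of each edge equation
    vanishes, and [off_row] makes the other two opposite; they vanish because
    their coefficients differ. *)
Lemma edge_off G a b d p q r p' q' r' : each4 diag_killed G ->
  uniq [:: a; b; d] -> edge_eqs a b p q r p' q' r' G -> q != r -> p' != r' ->
  G d a b b = 0 /\ G d b a a = 0.
Proof.
move=> G1 u; have u' : uniq [:: b; a; d].
  by move: u; rewrite /= !inE !negb_or [b == a]eq_sym => /and3P[/andP[-> ->] ->].
have := u; rewrite /= !inE negb_or !andbT => /andP[/andP[ab ad] bd].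
move=> /(_ d)[E0 E1] qr pr; have := off_row G1 u; have := off_row G1 u'.
have Z1 : G d a a a = 0 by case: G1 => _ _ _ /(_ a)[/(_ a d ad)].
have Z2 : G d b b b = 0 by case: G1 => _ _ _ /(_ b)[/(_ b d bd)].
move: E0 E1; rewrite Z1 Z2 => E0 E1 U2 U1.
split; [apply: (mulfI (_ : q - r != 0)); rewrite ?subr_eq0 // mulr0|].
  by lincomb (E0 +e (- r) *e U1).
apply: (mulfI (_ : p' - r' != 0)); rewrite ?subr_eq0 // mulr0.
by lincomb (E1 +e (- r') *e U2).
Qed.

Definition evec (a b : 'I_3) (s t : C) : 'I_3 -> C :=
  fun i => if i == a then s else if i == b then t else 0.

Lemma trisum_edge c a b s t s' t' : a != b -> s^* = s -> t^* = t -> s'^* = s' -> t'^* = t' ->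
  (forall w, unim w ->
    trisum c (evec a b s' (t' * w)) (evec a b s (t * w)) (evec a b s (t * w)) = 0) ->
  s' * s ^+ 2 * c a a a + s' * t ^+ 2 * c a b b + t' * s * t * c b a b = 0 /\
  t' * s ^+ 2 * c b a a + t' * t ^+ 2 * c b b b + s' * s * t * c a b a = 0.
Proof.
move=> ab sr tr s'r t'r H.
have := @laurent0
  (s' * s ^+ 2 * c a a a + s' * t ^+ 2 * c a b b + t' * s * t * c b a b)
  (t' * s ^+ 2 * c b a a + t' * t ^+ 2 * c b b b + s' * s * t * c a b a)
  (s' * s * t * c a a b) (t' * s * t * c b b a).
case=> // w u; rewrite -[RHS](H w u); move: ab {H}.
elim/I3_ind: a; elim/I3_ind: b => // _;
  rewrite /trisum !sum3 /evec /= ?rmorphM /= ?rmorph0 ?sr ?tr; ring: u.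
Qed.

End Torus.

(** * Uniqueness of torus-invariant forms *)

Section Torus2.
Variable C : numClosedFieldType.
Implicit Types (x y z : 'I_3 -> C) (G : tensor C 3) (c : 'I_3 -> 'I_3 -> 'I_3 -> C).

Lemma conjv_evec a b (s t w : C) : s^* = s -> t^* = t ->
  conjv (evec a b s (t * w^*)) =1 evec a b s (t * w).
Proof.
move=> sr tr i; rewrite /conjv /evec.
by case: ifP => _ //; case: ifP => _; rewrite ?rmorphM /= ?conjCK ?tr ?rmorph0.
Qed.

Lemma flat_edge G a b s t s' t' : a != b ->
  s^* = s -> t^* = t -> s'^* = s' -> t'^* = t' ->
  (forall w, unim w ->
     flat4 G (evec a b s (t * w)) (zv C) (evec a b s' (t' * w)) (zv C)) ->
  [/\ edge_eqs a b (s' * s ^+ 2) (s' * t ^+ 2) (t' * s * t)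
                   (t' * s ^+ 2) (t' * t ^+ 2) (s' * s * t) G,
      edge_eqs a b (s' * s ^+ 2) (s' * t ^+ 2) (t' * s * t)
                   (t' * s ^+ 2) (t' * t ^+ 2) (s' * s * t) (conjT G)
    & edge_eqs a b (s * s' ^+ 2) (s * t' ^+ 2) (t * s' * t')
                   (t * s' ^+ 2) (t * t' ^+ 2) (s * s' * t') (swapT G)].
Proof.
move=> ab sr tr s'r t'r H; split=> i; apply: trisum_edge => // w u.
- by have [/(_ i)[]] := H _ u.
- have [_ /(_ i)[+ _] _ _] := H _ (unimC u).
  have Ex := conjv_evec a b w sr tr; have Ey := conjv_evec a b w s'r t'r.
  by rewrite -[_ = 0 in X in X -> _]/(trisum _ _ _ _ = 0) (eq_trisum _ Ey Ex Ex).
- have [_ _ /(_ i)[+ _] _] := H _ (unimC u).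
  have Ex := conjv_evec a b w sr tr; have Ey := conjv_evec a b w s'r t'r.
  by rewrite -[_ = 0 in X in X -> _]/(trisum _ _ _ _ = 0) (eq_trisum _ Ex Ey Ey).
Qed.

(** The zeros x = (1, t w), y = (t, w) tend to a pair of basis vectors for
    t -> 0.  The first derivative along this line replaces the equation that is
    lost in the limit. *)
Lemma flat_edge0 G a b : a != b ->
  (forall w, unim w ->
     flat4 G (evec a b 1 0) (evec a b 0 w) (evec a b 0 w) (evec a b 1 0)) ->
  [/\ edge_eqs a b 1 0 1 1 0 0 G, edge_eqs a b 1 0 1 1 0 0 (conjT G)
    & edge_eqs a b 0 1 0 0 1 1 (swapT G)].
Proof.
move=> ab H.
have cE (s t : C) : conjv (evec a b s t) =1 evec a b s^* t^*.
  by move=> i; rewrite /conjv /evec; do 2 case: ifP => // _; rewrite rmorph0.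
have key c :
  (forall w, unim w ->
     trisum c (evec a b 0 w) (evec a b 1 0) (evec a b 1 0) = 0 /\
     trisum c (evec a b 1 0) (evec a b 1 0) (evec a b 1 0)
     + trisum c (evec a b 0 w) (evec a b 0 w) (evec a b 1 0)
     + trisum c (evec a b 0 w) (evec a b 1 0) (evec a b 0 w) = 0) ->
  c a a a + c b a b = 0 /\ c b a a = 0.
  move=> {}H; split.
    have [] := @laurent0 _ (c a a a + c b a b) 0 0 (c b b a); last by [].
    move=> w u; rewrite -[RHS](H w u).2; move: ab {H cE}.
    elim/I3_ind: a; elim/I3_ind: b => // _;
      rewrite /trisum !sum3 /evec /= ?rmorph0 ?rmorph1; ring: u.
  have u1 : unim (1 : C) by rewrite /unim rmorph1 mulr1.
  rewrite -[RHS](H 1 u1).1; move: ab {H cE}.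
  elim/I3_ind: a; elim/I3_ind: b => // _;
    rewrite /trisum !sum3 /evec /= ?rmorph0 ?rmorph1; ring.
have key' c :
  (forall w, unim w ->
     trisum c (evec a b 1 0) (evec a b 0 w) (evec a b 0 w) = 0 /\
     trisum c (evec a b 0 w) (evec a b 0 w) (evec a b 0 w)
     + trisum c (evec a b 1 0) (evec a b 1 0) (evec a b 0 w)
     + trisum c (evec a b 1 0) (evec a b 0 w) (evec a b 1 0) = 0) ->
  c a b b = 0 /\ c b b b + c a b a = 0.
  move=> {}H; split.
    have u1 : unim (1 : C) by rewrite /unim rmorph1 mulr1.
    rewrite -[RHS](H 1 u1).1; move: ab {H cE key}.
    elim/I3_ind: a; elim/I3_ind: b => // _;
      rewrite /trisum !sum3 /evec /= ?rmorph0 ?rmorph1; ring.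
  have [] := @laurent0 _ 0 (c b b b + c a b a) (c a a b) 0; last by [].
  move=> w u; rewrite -[RHS](H w u).2; move: ab {H cE key}.
  elim/I3_ind: a; elim/I3_ind: b => // _;
    rewrite /trisum !sum3 /evec /= ?rmorph0 ?rmorph1; ring: u.
split=> i.
- have [|] := key (G i); last by move=> E1 E2; split; [lincomb E1|lincomb E2].
  by move=> w u; have [/(_ i)] := H w u.
- have [|] := key (conjT G i); last by move=> E1 E2; split; [lincomb E1|lincomb E2].
  move=> w u; have [_ /(_ i) + _ _] := H _ (unimC u).
  rewrite -!/(trisum _ _ _ _).
  have E1 := cE 1 0; have E2 := cE 0 w^*; move: E1 E2; rewrite rmorph1 rmorph0 conjCK => E1 E2.
  by rewrite /rowsum -!/(trisum _ _ _ _) !(eq_trisum _ E2 E1 E1) !(eq_trisum _ E1 E1 E1) !(eq_trisum _ E2 E2 E1) !(eq_trisum _ E2 E1 E2).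
- have [|] := key' (swapT G i); last by move=> E1 E2; split; [lincomb E1|lincomb E2].
  move=> w u; have [_ _ /(_ i) + _] := H _ (unimC u).
  have E1 := cE 1 0; have E2 := cE 0 w^*; move: E1 E2; rewrite rmorph1 rmorph0 conjCK => E1 E2.
  by rewrite /rowsum -!/(trisum _ _ _ _) !(eq_trisum _ E1 E2 E2) !(eq_trisum _ E2 E2 E2) !(eq_trisum _ E1 E1 E2) !(eq_trisum _ E1 E2 E1).
Qed.

Lemma edges_off G p q r p' q' r' p1 q1 r1 p1' q1' r1' :
  each4 (@diag_killed C) G ->
  edge_eqs 0 1 p q r p' q' r' G -> edge_eqs 0 1 p q r p' q' r' (conjT G) ->
  edge_eqs 1 2 p1 q1 r1 p1' q1' r1' G ->
  edge_eqs 1 2 p1 q1 r1 p1' q1' r1' (conjT G) ->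
  q != r -> p' != r' -> q1 != r1 -> p1' != r1' ->
  forall a b d, uniq [:: a; b; d] -> G d a b b = 0.
Proof.
move=> G1 E01 C01 E12 C12 qr pr qr1 pr1.
have u0 : uniq [:: (0 : 'I_3); 1; 2] by [].
have u1 : uniq [:: (1 : 'I_3); 2; 0] by [].
have [H1 H2] := edge_off G1 u0 E01 qr pr.
have [H3 H4] := edge_off (each4_conj G1) u0 C01 qr pr.
have [H5 H6] := edge_off G1 u1 E12 qr1 pr1.
have [H7 H8] := edge_off (each4_conj G1) u1 C12 qr1 pr1.
by elim/I3_ind; elim/I3_ind; elim/I3_ind.
Qed.

(** The edge relations express the diagonal entries through G 0 0 0 0, G 0 0 1 1,
    G 1 1 2 2 and G 2 2 0 0.  If G 0 0 1 1 = 0, the equations [row_diag] are a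
    linear system in the other three, of determinant (1 - T) (1 - T^3) up to sign. *)
Lemma unique_cyclic G (T : C) : T != 1 -> T ^+ 2 + T + 1 != 0 ->
  each4 (@diag_killed C) G ->
  (forall a b, (a, b) \in [:: (0, 1); (1, 2); (2, 0)] ->
     [/\ edge_eqs a b 1 T 1 1 T T G, edge_eqs a b 1 T 1 1 T T (conjT G)
       & edge_eqs a b T 1 T T 1 1 (swapT G)]) ->
  G 0 0 1 1 = 0 -> forall i j k l, G i j k l = 0.
Proof.
move=> T1 T2 G1 E nu0.
have diag a b : (a, b) \in [:: (0, 1); (1, 2); (2, 0)] ->
    [/\ G a b a b = - G a a a a - T * G a a b b, G b a b a = G a b a b,
        G b b b b = G a a a a & G b b a a = T ^+ 2 * G a a b b].
  move=> /E[H Hc Hs]; have [e1 _] := H a; have [_ e2] := H b.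
  have [e3 _] := Hc a; have [e4 _] := Hs a; have [_ e5] := Hs b.
  rewrite /conjT in e3; rewrite /swapT in e4 e5.
  have B1 : G a b a b = - G a a a a - T * G a a b b.
    by apply/eqP; rewrite -subr_eq0; apply/eqP; lincomb e1.
  have B2 : G b a b a = - G a a a a - T * G a a b b.
    by apply/eqP; rewrite -subr_eq0; apply/eqP; lincomb e3.
  split; rewrite ?B1 ?B2 //; apply/eqP; rewrite -subr_eq0; apply/eqP.
    by move: e5; rewrite B2 => e5; lincomb e5.
  by move: e4; rewrite B1 => e4; lincomb e4.
have [b01 b10 a11 a10] := diag 0 1 isT.
have [b12 b21 a22 a21] := diag 1 2 isT.
have [b20 b02 a00 a02] := diag 2 0 isT.
have r0 := row_diag G1 (erefl : uniq [:: (0 : 'I_3); 1; 2]).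
have r1 := row_diag G1 (erefl : uniq [:: (1 : 'I_3); 2; 0]).
have r2 := row_diag G1 (erefl : uniq [:: (2 : 'I_3); 0; 1]).
rewrite a22 in a00 b20.
rewrite b02 a02 b20 b01 nu0 a11 in r0; rewrite b10 b01 a10 nu0 b12 a11 in r1.
rewrite b20 b21 a21 b12 a22 a11 in r2.
set mu := G 0 0 0 0 in r0 r1 r2; set nu' := G 1 1 2 2 in r0 r1 r2.
set nu'' := G 2 2 0 0 in r0 r1 r2.
have nu''0 : nu'' = 0.
  apply: (mulfI (_ : (1 - T) * (T ^+ 2 + T + 1) != 0)).
    by rewrite mulf_neq0 // subr_eq0 eq_sym.
  by rewrite mulr0; lincomb (r2 +e T *e r1 +e (- (T + 1)) *e r0).
have mu0 : mu = 0 by move: r0; rewrite nu''0 => r0; lincomb ((-1) *e r0).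
have nu'0 : nu' = 0.
  apply: (mulfI (_ : 1 - T != 0)); first by rewrite subr_eq0 eq_sym.
  by rewrite mulr0; move: r1; rewrite mu0 => r1; lincomb r1.
have [[e01 c01 _] [e12 c12 _]] := (E 0 1 isT, E 1 2 isT).
have T1' : 1 != T by rewrite eq_sym.
have U := edges_off G1 e01 c01 e12 c12 T1 T1' T1 T1'.
have b0 : G 0 1 0 1 = 0 by rewrite b01 -/mu mu0 nu0; ring.
have b1 : G 1 2 1 2 = 0 by rewrite b12 a11 -/mu mu0 -/nu' nu'0; ring.
have b2 : G 2 0 2 0 = 0 by rewrite b20 a11 -/mu mu0 -/nu'' nu''0; ring.
rewrite b0 in b10; rewrite b1 in b21; rewrite b2 in b02.
rewrite nu0 mulr0 in a10; rewrite -/nu' nu'0 mulr0 in a21.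
rewrite -/nu'' nu''0 mulr0 in a02; rewrite a11 -/mu mu0 in a22.
rewrite -/mu mu0 in a11.
by apply: (torus_vanish G1) U; elim/I3_ind; elim/I3_ind.
Qed.

(** Two edges carry zeros with a free phase, the third only an isolated zero,
    which gives G 0 0 2 2 = 0.  The diagonal entries reduce to multiples of
    G 0 0 1 1, and 1 - q^2 + p^2 q^2 is the coefficient that remains in the last
    equation. *)
Lemma unique_acyclic G (p q : C) :
  p != 0 -> q != 0 -> p * q != 1 -> 1 - q ^+ 2 + p ^+ 2 * q ^+ 2 != 0 ->
  each4 (@diag_killed C) G ->
  edge_eqs 0 1 q (q * p ^+ 2) p 1 (p ^+ 2) (q * p) G ->
  edge_eqs 0 1 q (q * p ^+ 2) p 1 (p ^+ 2) (q * p) (conjT G) ->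
  edge_eqs 0 1 (q ^+ 2) 1 (p * q) (p * q ^+ 2) p q (swapT G) ->
  edge_eqs 1 2 p (p * q ^+ 2) q 1 (q ^+ 2) (p * q) G ->
  edge_eqs 1 2 p (p * q ^+ 2) q 1 (q ^+ 2) (p * q) (conjT G) ->
  edge_eqs 1 2 (p ^+ 2) 1 (q * p) (q * p ^+ 2) q p (swapT G) ->
  G 0 0 2 2 = 0 -> G 0 1 0 1 = 0 -> forall i j k l, G i j k l = 0.
Proof.
move=> p0 q0 pq1 w0 G1 E01 C01 S01 E12 C12 S12 a02 b01.
have U : forall a b d, uniq [:: a; b; d] -> G d a b b = 0.
  apply: (edges_off G1 E01 C01 E12 C12).
  - by rewrite -subr_eq0 (_ : _ - _ = p * (p * q - 1)) ?mulf_neq0 ?subr_eq0 //; ring.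
  - by rewrite eq_sym mulrC.
  - by rewrite -subr_eq0 (_ : _ - _ = q * (p * q - 1)) ?mulf_neq0 ?subr_eq0 //; ring.
  - by rewrite eq_sym.
have [e1 _] := E01 0; have [_ e2] := E01 1; have [e3 _] := C01 0.
have [_ e5] := S01 1.
have [f1 _] := E12 1; have [_ f2] := E12 2; have [f3 _] := C12 1.
have [_ f5] := S12 2.
rewrite /conjT in e3 f3; rewrite /swapT in e5 f5.
have r0 := row_diag G1 (erefl : uniq [:: (0 : 'I_3); 1; 2]).
have r0' := row_diag (each4_conj G1) (erefl : uniq [:: (0 : 'I_3); 1; 2]).
have r1 := row_diag G1 (erefl : uniq [:: (1 : 'I_3); 2; 0]).
have r2 := row_diag G1 (erefl : uniq [:: (2 : 'I_3); 0; 1]).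
have c2 := col_diag G1 (erefl : uniq [:: (2 : 'I_3); 0; 1]).
rewrite /conjT in r0'.
rewrite a02 in r0 r0' c2; rewrite b01 in e1 r0.
set a := G 0 0 1 1 in e1 e3 r0 r0' e5 *.
have a00 : G 0 0 0 0 = - p ^+ 2 * a.
  by apply: (mulfI q0); apply/eqP; rewrite -subr_eq0; apply/eqP; lincomb e1.
have b10 : G 1 0 1 0 = 0.
  apply: (mulfI p0); rewrite mulr0; move: e3; rewrite a00 => e3.
  by lincomb e3.
rewrite b10 in e2 e3 e5 r0' r1.
have a11 : G 1 1 1 1 = - q ^+ 2 * a.
  by apply: (mulfI p0); apply/eqP; rewrite -subr_eq0; apply/eqP; lincomb e5.
have a10 : G 1 1 0 0 = p ^+ 2 * q ^+ 2 * a.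
  move: e2; rewrite a11 => e2.
  by apply/eqP; rewrite -subr_eq0; apply/eqP; lincomb e2.
set a' := G 1 1 2 2 in f1 f3 f5 r1 c2 *.
have b12 : G 1 2 1 2 = - p * q * (a' - a).
  move: f1; rewrite a11 => f1; apply: (mulfI q0).
  by apply/eqP; rewrite -subr_eq0; apply/eqP; lincomb f1.
have b21 : G 2 1 2 1 = - p * q * (a' - a).
  move: f3; rewrite a11 => f3; apply: (mulfI q0).
  by apply/eqP; rewrite -subr_eq0; apply/eqP; lincomb f3.
have a22 : G 2 2 2 2 = - p ^+ 2 * a.
  move: f5; rewrite b21 => f5; apply: (mulfI q0).
  by apply/eqP; rewrite -subr_eq0; apply/eqP; lincomb f5.
have b02 : G 0 2 0 2 = (p ^+ 2 - 1) * a.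
  by move: r0; rewrite a00 => r0; apply/eqP; rewrite -subr_eq0; apply/eqP; lincomb r0.
have b20 : G 2 0 2 0 = (p ^+ 2 - 1) * a.
  by move: r0'; rewrite a00 => r0'; apply/eqP; rewrite -subr_eq0; apply/eqP; lincomb r0'.
have a'E : a' - a = 0.
  apply: (mulfI (_ : 1 - p * q != 0)); first by rewrite subr_eq0 eq_sym.
  by rewrite mulr0; move: c2; rewrite a22 b20 b21 => c2; lincomb c2.
have a0 : a = 0.
  apply: (mulfI w0); rewrite mulr0; move: r1; rewrite a11 a10 b12 => r1.
  by lincomb (r1 +e (p * q - 1) *e a'E).
rewrite a0 subr0 in a'E; rewrite a'E a0 subr0 mulr0 in b12 b21.
rewrite a0 !mulr0 in a00 a11 a10 a22 b02 b20.
have a21 : G 2 2 1 1 = 0 by move: f2; rewrite a22 b21 => f2; lincomb f2.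
have a20 : G 2 2 0 0 = 0 by move: r2; rewrite a22 b20 a21 b21 => r2; lincomb r2.
by apply: (torus_vanish G1) U; elim/I3_ind; elim/I3_ind.
Qed.

End Torus2.

(** * Hermitian matrices of size three *)

Section Herm3.
Variable C : numClosedFieldType.
Implicit Types (A : 'M[C]_3) (y : 'I_3 -> C).

Lemma herm2_ge0 (p q e : C) (u v : C) :
  0 <= p -> 0 <= q -> 0 <= p * q - e * e^* ->
  0 <= p * (u * u^*) + (e * (u^* * v) + e^* * (u * v^*)) + q * (v * v^*).
Proof.
move=> p0 q0 pqe; have [pz|pnz] := eqVneq p 0.
  have e0 : e = 0.
    apply/eqP; rewrite -normr_eq0 -sqrf_eq0 normCK eq_le mul_conjC_ge0 andbT.
    by move: pqe; rewrite pz mul0r sub0r oppr_ge0.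
  by rewrite pz e0 conjC0 !mul0r !add0r mulr_ge0 ?mul_conjC_ge0.
have p_gt0 : 0 < p by rewrite lt0r pnz.
have pr : p^* = p by apply: conj_Creal; apply: ger0_real.
set Q := (X in 0 <= X); rewrite -(pmulr_rge0 Q p_gt0).
rewrite (_ : p * Q = (p * u + e * v) * (p * u + e * v)^* + (p * q - e * e^*) * (v * v^*)).
  by rewrite addr_ge0 ?mul_conjC_ge0 // mulr_ge0 ?mul_conjC_ge0.
by rewrite /Q rmorphD !rmorphM /= pr; ring.
Qed.

Definition det3 A := A 0 0 * A 1 1 * A 2 2 + A 0 1 * A 1 2 * A 2 0
  + A 0 2 * A 2 1 * A 1 0 - A 0 0 * A 1 2 * A 2 1 - A 1 1 * A 0 2 * A 2 0
  - A 2 2 * A 0 1 * A 1 0.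

Lemma qform3 A y : (forall i j, A i j = (A j i)^*) ->
  qform A y = A 0 0 * (y 0 * (y 0)^*) + A 1 1 * (y 1 * (y 1)^*) + A 2 2 * (y 2 * (y 2)^*)
   + (A 0 1 * ((y 0)^* * y 1) + (A 0 1)^* * (y 0 * (y 1)^*))
   + (A 0 2 * ((y 0)^* * y 2) + (A 0 2)^* * (y 0 * (y 2)^*))
   + (A 1 2 * ((y 1)^* * y 2) + (A 1 2)^* * (y 1 * (y 2)^*)).
Proof. by move=> h; rewrite -!h /qform !sum3; ring. Qed.

(** Completing the square in y 0 leaves a form in two variables, whose
    determinant is A 0 0 times [det3 A]. *)
Lemma herm3_ge0 A : (forall i j, A i j = (A j i)^*) -> 0 < A 0 0 ->
  0 <= A 0 0 * A 1 1 - A 0 1 * A 1 0 -> 0 <= A 0 0 * A 2 2 - A 0 2 * A 2 0 ->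
  0 <= det3 A -> forall y, 0 <= qform A y.
Proof.
move=> h a_gt0 m1 m2 d y.
rewrite -(pmulr_rge0 (qform A y) a_gt0).
pose e := A 0 0 * A 1 2 - A 1 0 * A 0 2.
have eC : e^* = A 0 0 * A 2 1 - A 0 1 * A 2 0.
  by rewrite /e rmorphB !rmorphM /= -!h.
pose l := A 0 0 * y 0 + A 0 1 * y 1 + A 0 2 * y 2.
rewrite (_ : A 0 0 * qform A y = l * l^* +
   ((A 0 0 * A 1 1 - A 0 1 * A 1 0) * (y 1 * (y 1)^*)
   + (e * ((y 1)^* * y 2) + e^* * (y 1 * (y 2)^*))
   + (A 0 0 * A 2 2 - A 0 2 * A 2 0) * (y 2 * (y 2)^*))).
  apply: addr_ge0; first exact: mul_conjC_ge0.
  apply: herm2_ge0 => //; rewrite eC.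
  rewrite (_ : _ - _ = A 0 0 * det3 A); last by rewrite /e /det3; ring.
  by apply: mulr_ge0 => //; exact: ltW.
rewrite eC /e /l !rmorphD !rmorphM /= -!h qform3 // -!h; ring.
Qed.

Lemma herm3_ge0_corner A : (forall i j, A i j = (A j i)^*) ->
  A 0 0 = 0 -> A 0 1 = 0 -> A 0 2 = 0 -> 0 <= A 1 1 -> 0 <= A 2 2 ->
  0 <= A 1 1 * A 2 2 - A 1 2 * A 2 1 -> forall y, 0 <= qform A y.
Proof.
move=> h a00 a01 a02 a11 a22 m y.
have := @herm2_ge0 (A 1 1) (A 2 2) (A 1 2) (y 1) (y 2) a11 a22.
rewrite -h => /(_ m); rewrite qform3 // a00 a01 a02 conjC0 !mul0r !add0r !addr0.
by rewrite -!h; congr (0 <= _); ring.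
Qed.

(** If A 0 0 = 0, the two minors that contain it force the first row to vanish
    and only the lower block is left; otherwise [herm3_ge0] applies. *)
Lemma herm3P (A : 'M[C]_3) : (forall i j, A i j = (A j i)^*) ->
  0 <= A 0 0 -> 0 <= A 1 1 -> 0 <= A 2 2 ->
  0 <= A 0 0 * A 1 1 - A 0 1 * A 1 0 -> 0 <= A 0 0 * A 2 2 - A 0 2 * A 2 0 ->
  (A 0 0 = 0 -> 0 <= A 1 1 * A 2 2 - A 1 2 * A 2 1) ->
  0 <= det3 A -> forall y, 0 <= qform A y.
Proof.
move=> h a00 a11 a22 m01 m02 m12 d.
have [a0|a0] := eqVneq (A 0 0) 0; last first.
  by apply: herm3_ge0 => //; rewrite lt0r a0.
have z i : 0 <= A 0 0 * A i i - A 0 i * A i 0 -> A 0 i = 0.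
  rewrite a0 mul0r sub0r oppr_ge0 [A i 0]h => le0.
  by apply/eqP; rewrite -normr_eq0 -sqrf_eq0 normCK eq_le mul_conjC_ge0 andbT.
by apply: herm3_ge0_corner => //; [exact: z|exact: z|exact: m12].
Qed.

End Herm3.

Section TorusMap.
Variable R : realType.
Local Notation C := R[i]%C.
Implicit Types (x y : 'I_3 -> C) (A B : 'I_3 -> 'I_3 -> R) (f : 'M[C]_3 -> 'M[C]_3).
Local Open Scope complex_scope.

Lemma conjRC (a : R) : (a%:C : C)^*%R = a%:C.
Proof. by apply: conj_Creal; apply/complex_realP; exists a. Qed.

Lemma rcD (a b : R) : (a + b)%:C = a%:C + b%:C :> C. Proof. exact: rmorphD. Qed.

Lemma rcN (a : R) : (- a)%:C = - a%:C :> C. Proof. exact: rmorphN. Qed.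

Lemma rcM (a b : R) : (a * b)%:C = a%:C * b%:C :> C. Proof. exact: rmorphM. Qed.

Lemma rcX (a : R) n : (a ^+ n)%:C = a%:C ^+ n :> C. Proof. exact: rmorphXn. Qed.

Lemma rc1 : 1%:C = 1 :> C. Proof. by []. Qed.

Lemma rc0 : 0%:C = 0 :> C. Proof. by []. Qed.

Lemma rcn n : (n%:R : R)%:C = n%:R :> C. Proof. exact: rmorph_nat. Qed.

Definition rcE := (rcD, rcN, rcM, rcX, rc1, rc0, rcn).

Definition sqn (z : C) : R := complex.Re z ^+ 2 + complex.Im z ^+ 2.

Lemma sqnE (z : C) : z * z^*%R = (sqn z)%:C.
Proof. by rewrite -normCK -add_Re2_Im2. Qed.

Lemma sqn_ge0 z : 0 <= sqn z.
Proof. by rewrite addr_ge0 ?sqr_ge0. Qed.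

(** Such a map commutes with conjugation by diagonal unitary matrices. *)
Definition torus_map A B f := forall Z i j, f Z i j =
  if i == j then \sum_k (A i k)%:C * Z k k else (B i j)%:C * Z i j.

Lemma torus_map_linear A B f : torus_map A B f -> linear f.
Proof.
move=> fE a X Y; apply/matrixP => i j; rewrite !mxE !fE; case: ifP => _.
  rewrite mulr_sumr -big_split; apply: eq_bigr => k _ /=.
  by rewrite !mxE; ring.
by rewrite !mxE; ring.
Qed.

Lemma torus_biform A B f x y : torus_map A B f ->
  biform (tens f) x y =
  \sum_i \sum_k (A i k)%:C * (x k * (x k)^*) * (y i * (y i)^*)
  + (B 0 1)%:C * (x 0 * (x 1)^* * ((y 0)^* * y 1))
  + (B 1 0)%:C * (x 1 * (x 0)^* * ((y 1)^* * y 0))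
  + (B 0 2)%:C * (x 0 * (x 2)^* * ((y 0)^* * y 2))
  + (B 2 0)%:C * (x 2 * (x 0)^* * ((y 2)^* * y 0))
  + (B 1 2)%:C * (x 1 * (x 2)^* * ((y 1)^* * y 2))
  + (B 2 1)%:C * (x 2 * (x 1)^* * ((y 2)^* * y 1)).
Proof.
move=> fE; rewrite (biform_tens (torus_map_linear fE)) /qform !sum3 !fE /=.
by rewrite !sum3 !mxE; ring.
Qed.

(** The phases of x cancel in the minors of f (rk1 x), so that only the squared
    moduli a k of the entries of x are left. *)
Lemma torus_map_positive A B f : torus_map A B f ->
  (forall i j, B i j = B j i) ->
  (forall i k, 0 <= A i k) ->
  (forall a : 'I_3 -> R, (forall k, 0 <= a k) ->
     let d i := A i 0 * a 0 + A i 1 * a 1 + A i 2 * a 2 in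
     [/\ B 0 1 ^+ 2 * a 0 * a 1 <= d 0 * d 1,
         B 0 2 ^+ 2 * a 0 * a 2 <= d 0 * d 2,
         B 1 2 ^+ 2 * a 1 * a 2 <= d 1 * d 2
       & 0 <= d 0 * d 1 * d 2 + 2 * B 0 1 * B 1 2 * B 0 2 * a 0 * a 1 * a 2
              - d 0 * B 1 2 ^+ 2 * a 1 * a 2 - d 1 * B 0 2 ^+ 2 * a 0 * a 2
              - d 2 * B 0 1 ^+ 2 * a 0 * a 1]) ->
  positive_map f.
Proof.
move=> fE Bsym A_ge0 H; have fL := torus_map_linear fE.
apply/(positive_map_biform fL) => x y; rewrite biform_tens //.
pose a k := sqn (x k); have a_ge0 k : 0 <= a k := sqn_ge0 _.
have aE k : (a k)%:C = x k * (x k)^*%R by rewrite sqnE.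
pose d i := A i 0 * a 0 + A i 1 * a 1 + A i 2 * a 2.
have [m01 m02 m12 dt] := H a a_ge0; rewrite -!/(d _) in m01 m02 m12 dt.
have dE i : f (rk1 x) i i = (d i)%:C.
  by rewrite fE eqxx sum3 !mxE !sqnE -!rcM -!rcD.
have d_ge0 i : 0 <= (d i)%:C by rewrite ler0c !addr_ge0 // mulr_ge0.
have oE i j : i != j -> f (rk1 x) i j = (B i j)%:C * (x i * (x j)^*%R).
  by move=> /negPf ij; rewrite fE ij mxE.
have mE i j : i != j -> f (rk1 x) i j * f (rk1 x) j i = (B i j ^+ 2 * a i * a j)%:C.
  move=> ij; rewrite !oE // 1?eq_sym // (Bsym j i) !(rcE, aE); ring.
have mge0 i j : i != j -> B i j ^+ 2 * a i * a j <= d i * d j ->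
    0 <= f (rk1 x) i i * f (rk1 x) j j - f (rk1 x) i j * f (rk1 x) j i.
  by move=> ij le; rewrite mE // !dE -rcM -rcN -rcD ler0c subr_ge0.
apply: herm3P; rewrite ?dE //.
- move=> i j; have [->|ij] := eqVneq i j; first by rewrite dE conjRC.
  by rewrite !oE // 1?eq_sym // (Bsym j i) !rmorphM /= conjCK conjRC; ring.
- by have := mge0 0 1 isT m01; rewrite !dE.
- by have := mge0 0 2 isT m02; rewrite !dE.
- by move=> _; have := mge0 1 2 isT m12; rewrite !dE.
move: dt; rewrite -ler0c; congr (0 <= _).
rewrite /det3 !dE !oE // (Bsym 1 0) (Bsym 2 0) (Bsym 2 1).
by rewrite !(rcE, aE); ring.
Qed.

End TorusMap.

(** * Determinants of the first two families *)

(** Squares are tried before products because x ^+ 2 also unifies with a product. *)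
Ltac posprod := repeat first
  [match goal with H : ?T |- ?T => exact: H end | exact: sqr_ge0 | apply: addr_ge0 | apply: mulr_ge0].

Section RealIneq.
Variable R : realType.
Implicit Types (t p q u v k a b c : R).

(** The determinant of Phi1 t (rk1 x), with a, b, c the squared moduli of the
    entries of x. *)
Definition det_cyc (t a b c : R) :=
  let d := (t ^+ 2 - 1) ^+ 2 in let f := t ^+ 4 in let e := t ^+ 4 - t ^+ 2 + 1 in
  let x := d * a + b + f * c in let y := f * a + d * b + c in let z := a + f * b + d * c in
  x * y * z - 2 * e ^+ 3 * a * b * c - x * e ^+ 2 * b * c - y * e ^+ 2 * a * c
  - z * e ^+ 2 * a * b.

(** The smallest variable is k; all terms on the right-hand side are then
    visibly nonnegative. *)
Lemma det_cyc_min t u v k : 0 <= u -> 0 <= v -> 0 <= k ->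
  0 <= det_cyc t (u + k) (v + k) k.
Proof.
move=> u0 v0 k0.
have -> : det_cyc t (u + k) (v + k) k = (t ^+ 2 - 1) ^+ 2 *
  ((t ^+ 4 - t ^+ 2 + 1) ^+ 2 * k * (u ^+ 2 - u * v + v ^+ 2)
   + (u + t ^+ 4 * v) * (t ^+ 2 * u - v) ^+ 2) by rewrite /det_cyc; ring.
have t4 : 0 <= t ^+ 4 by rewrite exprn_even_ge0.
have uv : 0 <= u ^+ 2 - u * v + v ^+ 2 by nra.
apply: mulr_ge0; first exact: sqr_ge0.
apply: addr_ge0.
  by apply: mulr_ge0 => //; apply: mulr_ge0 => //; exact: sqr_ge0.
apply: mulr_ge0; last exact: sqr_ge0.
by apply: addr_ge0 => //; exact: mulr_ge0.
Qed.

Lemma det_cyc_rot t a b c : det_cyc t a b c = det_cyc t b c a.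
Proof. by rewrite /det_cyc; ring. Qed.

Lemma det_cyc_ge0 t a b c : 0 <= a -> 0 <= b -> 0 <= c -> 0 <= det_cyc t a b c.
Proof.
have key x y z : 0 <= x -> 0 <= y -> 0 <= z -> z <= x -> z <= y -> 0 <= det_cyc t x y z.
  move=> x0 y0 z0 zx zy; rewrite -[x](subrK z) -[y](subrK z).
  by apply: det_cyc_min; rewrite ?subr_ge0.
move=> a0 b0 c0; have [ab|/ltW ba] := leP a b; have [bc|/ltW cb] := leP b c.
- by rewrite det_cyc_rot; apply: key => //; exact: le_trans bc.
- have [ac|/ltW ca] := leP a c; last exact: key.
  by rewrite det_cyc_rot; apply: key.
- by rewrite det_cyc_rot det_cyc_rot; apply: key.
- by apply: key => //; exact: le_trans ba.
Qed.

Lemma minor_cyc t a b c : 0 <= a -> 0 <= b -> 0 <= c ->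
  (t ^+ 4 - t ^+ 2 + 1) ^+ 2 * a * b <=
  ((t ^+ 2 - 1) ^+ 2 * a + b + t ^+ 4 * c) * (t ^+ 4 * a + (t ^+ 2 - 1) ^+ 2 * b + c).
Proof.
move=> a0 b0 c0; rewrite -subr_ge0.
set d := (t ^+ 2 - 1) ^+ 2; have d0 : 0 <= d by rewrite sqr_ge0.
have t4 : 0 <= t ^+ 4 by rewrite exprn_even_ge0.
rewrite (_ : _ - _ = d * (t ^+ 2 * a - b) ^+ 2
  + c * (d * a + b + t ^+ 4 * (t ^+ 4 * a + d * b + c))); last by rewrite /d; ring.
by posprod.
Qed.

Definition acyc_form p q u v :=
  p ^+ 2 * (1 - 2 * q ^+ 2 + p ^+ 2 * q ^+ 2 + q ^+ 4 - p ^+ 4 * q ^+ 4) * u ^+ 2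
  - p ^+ 2 * (1 - 2 * q ^+ 2 + 3 * q ^+ 4 - 2 * p ^+ 2 * q ^+ 4 - p ^+ 4 * q ^+ 4) * u * v
  + q ^+ 2 * (1 - 2 * p ^+ 2 + 2 * p ^+ 2 * q ^+ 2 - 2 * p ^+ 4 * q ^+ 2) * v ^+ 2.

(** As a quadratic polynomial in v it has a positive leading coefficient c, and
    its discriminant is minus a square times the quantity in [disc]. *)
Lemma acyc_form_ge0 p q u v : 0 < p -> 0 < q -> 2 * p ^+ 2 <= 1 ->
  0 <= 2 * p - q -> 0 <= (p ^+ 2 - 1) ^+ 2 * q ^+ 2 - p ^+ 2 ->
  0 <= acyc_form p q u v.
Proof.
move=> p0 q0 p2 pq s0; pose w := 1 - q ^+ 2 + p ^+ 2 * q ^+ 2.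
pose c := q ^+ 2 * (1 - 2 * p ^+ 2 + 2 * p ^+ 2 * q ^+ 2 - 2 * p ^+ 4 * q ^+ 2).
pose b := p ^+ 2 * (1 - 2 * q ^+ 2 + 3 * q ^+ 4 - 2 * p ^+ 2 * q ^+ 4 - p ^+ 4 * q ^+ 4).
have pp : 0 < p ^+ 2 by rewrite exprn_gt0.
have qq : 0 < q ^+ 2 by rewrite exprn_gt0.
have c_gt0 : 0 < c.
  rewrite mulr_gt0 // (_ : _ - _ = (1 - 2 * p ^+ 2) + 2 * (p ^+ 2 * q ^+ 2) * (1 - p ^+ 2)); last by ring.
  have h1 : 0 <= 1 - 2 * p ^+ 2 by lra.
  have h2 : 0 < 1 - p ^+ 2 by lra.
  by apply: ltr_wpDl => //; rewrite !mulr_gt0.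
have disc : 0 <= 4 * (q ^+ 2 * (1 - p ^+ 2)) - p ^+ 2 * (1 + q ^+ 2 * (1 - p ^+ 2)) ^+ 2.
  set y := q ^+ 2 * (1 - p ^+ 2); set z := p ^+ 2.
  have z2 : 2 * z <= 1 by []; have z0 : 0 < z by [].
  have y1 : z <= y * (1 - z).
    by rewrite -subr_ge0; move: s0; congr (0 <= _); rewrite /y /z; ring.
  have q4 : q ^+ 2 <= 4 * z.
    rewrite -subr_ge0 (_ : _ - _ = (2 * p - q) * (2 * p + q)); last by rewrite /z; ring.
    by rewrite mulr_ge0 // addr_ge0 // ?mulr_ge0 // ltW.
  have y0 : 0 <= y by rewrite mulr_ge0 // ?ltW // subr_gt0 -/z; lra.
  have y2 : y <= 4 * z * (1 - z) by rewrite ler_wpM2r // subr_ge0; lra.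
  have y3 : y <= 1 by have := sqr_ge0 (1 - 2 * z); nra.
  have y4 : z <= y by have := mulr_ge0 y0 (ltW z0); nra.
  have h1 : 0 <= z * (y * (1 - y)).
    by apply: mulr_ge0; [exact: ltW|apply: mulr_ge0; rewrite ?subr_ge0].
  have h2 : 0 <= (y - z) * (4 - 3 * z) by rewrite mulr_ge0 ?subr_ge0 //; lra.
  have h3 : 0 <= z * (1 - z) by rewrite mulr_ge0 ?subr_ge0 //; lra.
  by lra.
have c4 : 0 < 4 * c by rewrite mulr_gt0.
rewrite -(pmulr_rge0 (acyc_form p q u v) c4).
rewrite (_ : 4 * c * acyc_form p q u v = (2 * c * v - b * u) ^+ 2 + p ^+ 2 * w ^+ 2 *
   (4 * (q ^+ 2 * (1 - p ^+ 2)) - p ^+ 2 * (1 + q ^+ 2 * (1 - p ^+ 2)) ^+ 2) * u ^+ 2).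
  by have := ltW p0 => ?; posprod.
by rewrite /acyc_form /c /b /w; ring.
Qed.

Definition tab3 (rows : seq (seq R)) (i k : 'I_3) : R := (nth [::] rows i)`_k.

Section AcyclicIneq.
Variables p q : R.
Let e := (p * q - 1) ^+ 2.
Let d := q * (2 * p - q).
Let s := (p ^+ 2 - 1) ^+ 2 * q ^+ 2 - p ^+ 2.
Let k := - (p * q * (1 - q ^+ 2 + p ^+ 2 * q ^+ 2)).
Let l := (p * q - 1) * (p ^+ 2 + p * q - p ^+ 3 * q - q ^+ 2 + p ^+ 2 * q ^+ 2).
Let x (a b c : R) := p ^+ 2 * e * a + d * b + 0 * c.
Let y (a b c : R) := p ^+ 2 * q ^+ 2 * d * a + q ^+ 2 * e * b + d * c.
Let z (a b c : R) :=
  d * (1 - p ^+ 2 * q ^+ 2) * a + p ^+ 2 * q ^+ 2 * d * b + p ^+ 2 * e * c.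

Definition det_acyc (a b c : R) :=
  x a b c * y a b c * z a b c + 2 * k * k * l * a * b * c
  - x a b c * k ^+ 2 * b * c - y a b c * l ^+ 2 * a * c - z a b c * k ^+ 2 * a * b.

(** The cofactor of a square in [det_acyc]; the square vanishes only on the
    boundary of the parameter region. *)
Definition acyc_cubic (a b c : R) :=
  p ^+ 2 * b * c ^+ 2 - 2 * p ^+ 2 * q ^+ 2 * b ^+ 2 * c + p ^+ 2 * q ^+ 4 * b ^+ 3
  + ((p ^+ 2 - 1) ^+ 2 * q ^+ 2 - p ^+ 2) * a * c ^+ 2
  + (6 * p ^+ 2 * q ^+ 2 - p ^+ 2 - 2 * q ^+ 2 - p ^+ 6 * q ^+ 4 + 2 * p ^+ 4 * q ^+ 4 - p ^+ 2 * q ^+ 4) * a * b * c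
  + q ^+ 2 * (1 - p ^+ 2 * q ^+ 2 - 2 * p ^+ 4 * q ^+ 2) * a * b ^+ 2
  + p ^+ 2 * (p ^+ 4 * q ^+ 4 - 2 * p ^+ 2 * q ^+ 4 - 2 * p ^+ 2 * q ^+ 2 + q ^+ 4 + 1) * a ^+ 2 * c
  + p ^+ 2 * q ^+ 2 * (p ^+ 4 * q ^+ 2 + 2 * p ^+ 2 * q ^+ 2 - 2) * a ^+ 2 * b
  + p ^+ 4 * q ^+ 2 * (1 - p ^+ 2 * q ^+ 2) * a ^+ 3.
Lemma acyc_kE : k = - (p * q * (e + d)).
Proof. by rewrite /k /e /d; ring. Qed.

Lemma acyc_lE : l = p * q * (e + d) - d - p ^+ 2 * e.
Proof. by rewrite /l /e /d; ring. Qed.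

Lemma det_acycE a b c : det_acyc a b c = d ^+ 2 * e * acyc_cubic a b c.
Proof. by rewrite /det_acyc acyc_lE acyc_kE /x /y /z /acyc_cubic /e /d; ring. Qed.

(** In this and the two next identities h is the smallest of the variables a,
    b, c, namely c, a and b respectively.  Whichever it is, the terms that
    contain h are h times a value of the same quadratic form. *)
Lemma acyc_cubic_min2 u v h : acyc_cubic (u + h) (v + h) h =
  h * acyc_form p q u v
  + q ^+ 2 * ((1 - p ^+ 2 * q ^+ 2) * u + p ^+ 2 * q ^+ 2 * v) * (p ^+ 2 * u - v) ^+ 2.
Proof. by rewrite /acyc_cubic /acyc_form; ring. Qed.

Lemma acyc_cubic_min0 u v h : acyc_cubic h (u + h) (v + h) =
  h * acyc_form p q (- v) (u - v) + p ^+ 2 * u * (q ^+ 2 * u - v) ^+ 2.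
Proof. by rewrite /acyc_cubic /acyc_form; ring. Qed.

Lemma acyc_cubic_min1 u v h : acyc_cubic (u + h) h (v + h) =
  h * acyc_form p q (u - v) (- v)
  + (p ^+ 2 * q ^+ 2 * u + v) * u * (p ^+ 2 * (1 - p ^+ 2 * q ^+ 2) * u + s * v).
Proof. by rewrite /acyc_cubic /acyc_form /s; ring. Qed.

Lemma acyc_minors a b c : 0 < p -> 0 < q -> 2 * p ^+ 2 <= 1 ->
  0 <= 2 * p - q -> p * q < 1 -> 0 <= s ->
  0 <= a -> 0 <= b -> 0 <= c ->
  [/\ k ^+ 2 * a * b <= x a b c * y a b c, l ^+ 2 * a * c <= x a b c * z a b c,
      k ^+ 2 * b * c <= y a b c * z a b c & 0 <= det_acyc a b c].
Proof.
move=> p0 q0 p2 pq pq1 s0 a0 b0 c0.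
have e0 : 0 <= e by rewrite sqr_ge0.
have d0 : 0 <= d by rewrite mulr_ge0 // ltW.
have p20 : 0 <= p ^+ 2 by rewrite sqr_ge0.
have q20 : 0 <= q ^+ 2 by rewrite sqr_ge0.
have g0 : 0 <= 1 - p ^+ 2 * q ^+ 2.
  rewrite (_ : _ - _ = (1 - p * q) * (1 + p * q)); last by ring.
  by rewrite mulr_ge0 ?subr_ge0 ?ltW // addr_gt0 // mulr_gt0.
have minor01 : x a b c * y a b c - k ^+ 2 * a * b =
    q ^+ 2 * e * d * (p ^+ 2 * a - b) ^+ 2 + d * c * (p ^+ 2 * e * a + d * b).
  by rewrite /x /y /k /e /d; ring.
have minor02 : x a b c * z a b c - l ^+ 2 * a * c =
    e * d * a * (p ^+ 2 * (1 - p ^+ 2 * q ^+ 2) * a + s * c)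
    + d * b * z a b c + p ^+ 2 * e * a * (p ^+ 2 * q ^+ 2 * d * b).
  by rewrite /x /z /l /e /d /s; ring.
have minor12 : y a b c * z a b c - k ^+ 2 * b * c =
    p ^+ 2 * e * d * (q ^+ 2 * b - c) ^+ 2 + p ^+ 2 * q ^+ 2 * d * a * z a b c
    + d * (1 - p ^+ 2 * q ^+ 2) * a * (q ^+ 2 * e * b + d * c).
  by rewrite /y /z /k /e /d; ring.
have z0 : 0 <= z a b c by rewrite /z; posprod.
have f0 u v : 0 <= acyc_form p q u v by apply: acyc_form_ge0.
split.
- by rewrite -subr_ge0 minor01; posprod.
- by rewrite -subr_ge0 minor02; posprod.
- by rewrite -subr_ge0 minor12; posprod.
rewrite det_acycE; apply: mulr_ge0; first by posprod.
have [ac|/ltW ca] := leP a c; have [ab|/ltW ba] := leP a b.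
- rewrite -[b](subrK a) -[c](subrK a) acyc_cubic_min0.
  have bae : 0 <= b - a by rewrite subr_ge0.
  by apply: addr_ge0; [exact: mulr_ge0|posprod].
- rewrite -[a](subrK b) -[c](subrK b) acyc_cubic_min1.
  have h1 : 0 <= a - b by rewrite subr_ge0.
  have h2 : 0 <= c - b by rewrite subr_ge0 (le_trans ba).
  by apply: addr_ge0; [exact: mulr_ge0|posprod].
- rewrite -[a](subrK c) -[b](subrK c) acyc_cubic_min2.
  have h1 : 0 <= a - c by rewrite subr_ge0.
  have h2 : 0 <= b - c by rewrite subr_ge0 (le_trans ca).
  by apply: addr_ge0; [exact: mulr_ge0|posprod].
have [bc|/ltW cb] := leP b c.
- rewrite -[a](subrK b) -[c](subrK b) acyc_cubic_min1.
  have h1 : 0 <= a - b by rewrite subr_ge0.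
  have h2 : 0 <= c - b by rewrite subr_ge0.
  by apply: addr_ge0; [exact: mulr_ge0|posprod].
- rewrite -[a](subrK c) -[b](subrK c) acyc_cubic_min2.
  have h1 : 0 <= a - c by rewrite subr_ge0.
  have h2 : 0 <= b - c by rewrite subr_ge0.
  by apply: addr_ge0; [exact: mulr_ge0|posprod].
Qed.

End AcyclicIneq.
End RealIneq.

(** * The first two families *)

Section FamiliesI_II.
Variable R : realType.
Local Notation C := R[i]%C.
Local Open Scope complex_scope.
Implicit Types (t p q : R) (a b : 'I_3) (w : C).

Definition cyc_tab (t : R) := tab3 [::
  [:: (t ^+ 2 - 1) ^+ 2; 1; t ^+ 4];
  [:: t ^+ 4; (t ^+ 2 - 1) ^+ 2; 1];
  [:: 1; t ^+ 4; (t ^+ 2 - 1) ^+ 2]].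

Lemma Phi1_torus t : torus_map (cyc_tab t) (fun _ _ => - (t ^+ 4 - t ^+ 2 + 1)) (Phi1 t).
Proof.
move=> Z; rewrite rcN; elim/I3_ind; elim/I3_ind;
  rewrite ?sum3 /Phi1 /mx3 mxE /cyc_tab /tab3 /= ?(@rc1 R); ring.
Qed.

Lemma Phi1_positive t : positive_map (Phi1 t).
Proof.
apply: (torus_map_positive (Phi1_torus t)) => //.
  by elim/I3_ind; elim/I3_ind; rewrite /cyc_tab /tab3 /= ?sqr_ge0 ?exprn_even_ge0.
move=> a a0 /=; rewrite /cyc_tab /tab3 /= !sqrrN.
have m x y z (x0 : 0 <= x) (y0 : 0 <= y) (z0 : 0 <= z) := minor_cyc t x0 y0 z0.
split.
- by move: (m _ _ _ (a0 0) (a0 1) (a0 2)); rewrite !mul1r.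
- by move: (m _ _ _ (a0 2) (a0 0) (a0 1)); congr (_ <= _); ring.
- by move: (m _ _ _ (a0 1) (a0 2) (a0 0)); congr (_ <= _); ring.
by move: (det_cyc_ge0 t (a0 0) (a0 1) (a0 2)); congr (_ <= _); rewrite /det_cyc; ring.
Qed.

Lemma Phi1_ones t w1 w2 : unim w1 -> unim w2 ->
  biform (tens (Phi1 t)) (vec3 1 w1 w2) (vec3 1 w1 w2) = 0.
Proof.
move=> u1 u2; rewrite (torus_biform _ _ (Phi1_torus t)) !sum3 /vec3 /cyc_tab /tab3 /=.
by rewrite ?rmorph1 !rcE; ring: u1 u2.
Qed.

Lemma Phi1_edge t a b w : (a, b) \in [:: (0, 1); (1, 2); (2, 0)] -> unim w ->
  biform (tens (Phi1 t)) (evec a b 1 (t%:C * w)) (evec a b t%:C (1 * w)) = 0.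
Proof.
move=> ab u; rewrite (torus_biform _ _ (Phi1_torus t)) !sum3; move: ab.
by elim/I3_ind: a; elim/I3_ind: b => // _; rewrite /evec /cyc_tab /tab3 /=
  ?rmorphM ?rmorph1 ?rmorph0 /= ?conjRC !rcE; ring: u.
Qed.

Lemma Phi10_edge a b w (s : C) : (a, b) \in [:: (0, 1); (1, 2); (2, 0)] -> unim w ->
  0 < s ->
  biform (tens (Phi1 0)) (line (evec a b 1 0) (evec a b 0 w) s)
    (line (evec a b 0 w) (evec a b 1 0) s) = 1 * s ^+ 4.
Proof.
move=> ab u s0; have sr : s^*%R = s by apply: conj_Creal; apply: gtr0_real.
rewrite (torus_biform _ _ (Phi1_torus 0)) !sum3; move: ab.
by elim/I3_ind: a; elim/I3_ind: b => // _; rewrite /line /evec /cyc_tab /tab3 /=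
  ?rmorphD ?rmorphM ?rmorph1 ?rmorph0 /= ?sr !rcE; ring: u.
Qed.

Lemma Phi1_extremal t : t != 1 -> t != -1 -> extremal_positive_map (Phi1 t).
Proof.
move=> t1 t1'; apply: (@extremal_of_flat _ _ _ 0 0 1 1); first exact: Phi1_positive.
  by rewrite /tens Phi1_torus /= sum3 !mxE /= /cyc_tab /tab3 /= !mulr0 mulr1 addr0 add0r oner_eq0.
move=> G HG; have HZ := flat_zero HG.
apply: (@unique_cyclic _ _ (t ^+ 2)%:C).
- rewrite -rc1 -subr_eq0 -rcN -rcD (inj_eq (@complexI R)) subr_sqr_1 mulf_neq0 //.
    by rewrite subr_eq0.
  by rewrite addr_eq0.
- have -> : (t ^+ 2)%:C ^+ 2 + (t ^+ 2)%:C + 1 = ((t ^+ 2) ^+ 2 + t ^+ 2 + 1)%:C.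
    by rewrite !rcE.
  rewrite -rc0 (inj_eq (@complexI R)); apply: lt0r_neq0.
  by rewrite ltr_wpDl // addr_ge0 ?sqr_ge0.
- by apply: flat_ones => w1 w2 u1 u2; apply/HZ/Phi1_ones.
move=> a b ab; have ab' : a != b by move: ab; elim/I3_ind: a; elim/I3_ind: b.
have [t0|t0] := eqVneq t 0.
  have [|E1 E2 E3] := @flat_edge0 _ G a b ab'.
    by move=> w u; apply: (HG _ _ _ _ 1) => s /andP[s0 _]; rewrite t0 Phi10_edge.
  by rewrite t0 expr0n.
have t0' : t%:C != 0 by rewrite -rc0 (inj_eq (@complexI R)).
have [|||||E1 E2 E3] := @flat_edge _ G a b 1 t%:C t%:C 1 ab'; rewrite ?rmorph1 ?conjRC //.
  by move=> w u; apply/HZ/Phi1_edge.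
split=> i.
- have [H1 H2] := E1 i; rewrite rcX; split; last by lincomb H2.
  by apply: (mulfI t0'); rewrite mulr0; lincomb H1.
- have [H1 H2] := E2 i; rewrite rcX; split; last by lincomb H2.
  by apply: (mulfI t0'); rewrite mulr0; lincomb H1.
- have [H1 H2] := E3 i; rewrite rcX; split; first by lincomb H1.
  by apply: (mulfI t0'); rewrite mulr0; lincomb H2.
Qed.

Definition acyc_tab p q :=
  let e := (p * q - 1) ^+ 2 in let d := q * (2 * p - q) in tab3 [::
  [:: p ^+ 2 * e; d; 0];
  [:: p ^+ 2 * q ^+ 2 * d; q ^+ 2 * e; d];
  [:: d * (1 - p ^+ 2 * q ^+ 2); p ^+ 2 * q ^+ 2 * d; p ^+ 2 * e]].

Definition acyc_off p q :=
  let k := - (p * q * (1 - q ^+ 2 + p ^+ 2 * q ^+ 2)) in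
  let l := (p * q - 1) * (p ^+ 2 + p * q - p ^+ 3 * q - q ^+ 2 + p ^+ 2 * q ^+ 2) in
  tab3 [:: [:: 0; k; l]; [:: k; 0; k]; [:: l; k; 0]].

Lemma Phi2_torus p q : torus_map (acyc_tab p q) (acyc_off p q) (Phi2 p q).
Proof.
move=> Z; elim/I3_ind; elim/I3_ind;
  rewrite ?sum3 /Phi2 /mx3 mxE /acyc_tab /acyc_off /tab3 /= !rcE; ring.
Qed.

Lemma Phi2_ones p q w1 w2 : unim w1 -> unim w2 ->
  biform (tens (Phi2 p q)) (vec3 1 w1 w2) (vec3 1 w1 w2) = 0.
Proof.
move=> u1 u2; rewrite (torus_biform _ _ (Phi2_torus p q)) !sum3 /vec3.
by rewrite /acyc_tab /acyc_off /tab3 /= ?rmorph1 !rcE; ring: u1 u2.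
Qed.

Lemma Phi2_edge01 p q w : unim w ->
  biform (tens (Phi2 p q)) (evec 0 1 1 (p%:C * w)) (evec 0 1 q%:C (1 * w)) = 0.
Proof.
move=> u; rewrite (torus_biform _ _ (Phi2_torus p q)) !sum3 /evec.
by rewrite /acyc_tab /acyc_off /tab3 /= ?rmorphM ?rmorph1 ?rmorph0 /= ?conjRC !rcE; ring: u.
Qed.

Lemma Phi2_edge12 p q w : unim w ->
  biform (tens (Phi2 p q)) (evec 1 2 1 (q%:C * w)) (evec 1 2 p%:C (1 * w)) = 0.
Proof.
move=> u; rewrite (torus_biform _ _ (Phi2_torus p q)) !sum3 /evec.
by rewrite /acyc_tab /acyc_off /tab3 /= ?rmorphM ?rmorph1 ?rmorph0 /= ?conjRC !rcE; ring: u.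
Qed.

Lemma Phi2_corner p q : biform (tens (Phi2 p q)) (vec3 0 0 1) (vec3 1 0 0) = 0.
Proof.
rewrite (torus_biform _ _ (Phi2_torus p q)) !sum3 /vec3.
by rewrite /acyc_tab /acyc_off /tab3 /= ?rmorph0 !rcE; ring.
Qed.

Section Phi2.
Variables p q : R.
Hypotheses (p0 : 0 < p) (q0 : 0 < q) (p2 : 2 * p ^+ 2 <= 1)
  (pq : 0 <= 2 * p - q) (pq1 : p * q < 1)
  (s0 : 0 <= (p ^+ 2 - 1) ^+ 2 * q ^+ 2 - p ^+ 2).

Lemma Phi2_positive : positive_map (Phi2 p q).
Proof.
have g0 : 0 <= 1 - p ^+ 2 * q ^+ 2.
  rewrite (_ : _ - _ = (1 - p * q) * (1 + p * q)); last by ring.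
  by rewrite mulr_ge0 ?subr_ge0 ?ltW // addr_gt0 // mulr_gt0.
have d0 : 0 <= q * (2 * p - q) by rewrite mulr_ge0 // ltW.
apply: (torus_map_positive (Phi2_torus p q)).
- by elim/I3_ind; elim/I3_ind.
- by elim/I3_ind; elim/I3_ind; rewrite /acyc_tab /tab3 //=; posprod.
move=> a a0 d.
have [m01 m02 m12 dt] := acyc_minors p0 q0 p2 pq pq1 s0 (a0 0) (a0 1) (a0 2).
split; [exact: m01|exact: m02|exact: m12|].
by move: dt; congr (_ <= _); rewrite /det_acyc /d /acyc_tab /acyc_off /tab3 /=; ring.
Qed.

Lemma Phi2_extremal_pos : extremal_positive_map (Phi2 p q).
Proof.
have pn0 : p%:C != 0 by rewrite -rc0 (inj_eq (@complexI R)) gt_eqF.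
have qn0 : q%:C != 0 by rewrite -rc0 (inj_eq (@complexI R)) gt_eqF.
have pqn1 : p%:C * q%:C != 1.
  by rewrite -rcM -rc1 (inj_eq (@complexI R)) lt_eqF.
have w0 : 0 < 1 - q ^+ 2 + p ^+ 2 * q ^+ 2.
  rewrite (_ : _ + _ = (1 - p * q) ^+ 2 + q * (2 * p - q)); last by ring.
  by rewrite ltr_pwDl ?exprn_gt0 ?subr_gt0 // mulr_ge0 // ltW.
apply: (@extremal_of_flat _ _ _ 0 1 0 1); first exact: Phi2_positive.
  rewrite /tens Phi2_torus /= !mxE /= mulr1 /acyc_off /tab3 /=.
  by rewrite -rc0 (inj_eq (@complexI R)) oppr_eq0 !mulf_neq0 // gt_eqF.
move=> G HG; have HZ := flat_zero HG => b01.
have [|||||E1 E2 E3] := @flat_edge _ G 0 1 1 p%:C q%:C 1 isT; rewrite ?rmorph1 ?conjRC //.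
  by move=> w u; apply/HZ/Phi2_edge01.
have [|||||F1 F2 F3] := @flat_edge _ G 1 2 1 q%:C p%:C 1 isT; rewrite ?rmorph1 ?conjRC //.
  by move=> w u; apply/HZ/Phi2_edge12.
apply: (unique_acyclic pn0 qn0 pqn1) b01.
- rewrite -!rcX -rcM -rc1 -rcN -!rcD (inj_eq (@complexI R)) gt_eqF //.
- by apply: flat_ones => w1 w2 u1 u2; apply/HZ/Phi2_ones.
- by move=> i; have [H1 H2] := E1 i; split; [lincomb H1|lincomb H2].
- by move=> i; have [H1 H2] := E2 i; split; [lincomb H1|lincomb H2].
- by move=> i; have [H1 H2] := E3 i; split; [lincomb H1|lincomb H2].
- by move=> i; have [H1 H2] := F1 i; split; [lincomb H1|lincomb H2].
- by move=> i; have [H1 H2] := F2 i; split; [lincomb H1|lincomb H2].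
- by move=> i; have [H1 H2] := F3 i; split; [lincomb H1|lincomb H2].
have [/(_ 0)[+ _] _ _ _] := HZ _ _ (Phi2_corner p q).
by rewrite /rowsum !sum3 /vec3 /= ?rmorph0 ?rmorph1 => <-; ring.
Qed.

End Phi2.

Lemma Phi2_extremal p q : 0 <= p <= 1 / Num.sqrt 2 -> 0 <= q <= Num.sqrt 2 ->
  0 <= 2 * p - q -> 0 <= (p ^+ 2 - 1) ^+ 2 * q ^+ 2 - p ^+ 2 ->
  (p, q) != (0, 0) -> (p, q) != (1 / Num.sqrt 2, Num.sqrt 2) ->
  extremal_positive_map (Phi2 p q).
Proof.
move=> /andP[p_ge0 p_le] /andP[q_ge0 q_le] pq s0 pq0 pq1.
set r := Num.sqrt 2 in p_le q_le pq1.
have r0 : 0 < r by rewrite sqrtr_gt0.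
have r2 : r ^+ 2 = 2 by rewrite sqr_sqrtr.
have p0 : 0 < p.
  rewrite lt_neqAle p_ge0 andbT eq_sym; apply/eqP => pz.
  move/eqP: pq0; apply; rewrite pz; congr (_, _); apply: le_anti.
  by rewrite q_ge0 andbT; move: pq; rewrite pz; lra.
have q0 : 0 < q.
  rewrite lt_neqAle q_ge0 andbT eq_sym; apply/eqP => qz; move: s0.
  by rewrite qz expr0n mulr0 sub0r oppr_ge0 leNgt exprn_gt0.
apply: Phi2_extremal_pos => //.
  have : p * r <= 1 by rewrite -ler_pdivlMr.
  have pr0 : 0 <= p * r by apply: mulr_ge0; exact: ltW.
  by move=> pr; rewrite -r2 -exprMn mulrC expr_le1.
rewrite lt_neqAle; apply/andP; split; last first.
  apply: le_trans (_ : p * r <= 1); first by rewrite ler_wpM2l.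
  by rewrite -ler_pdivlMr.
apply/eqP => pqE; move/eqP: pq1; apply.
have qr : q = r.
  apply: le_anti; rewrite q_le /=.
  have : p * r <= 1 by rewrite -ler_pdivlMr.
  by rewrite -pqE ler_pM2l.
by rewrite qr; congr (_, _); rewrite -pqE qr mulfK // gt_eqF.
Qed.

End FamiliesI_II.

(** * Uniqueness for the third family *)

Section Mixed.
Variable C : numClosedFieldType.
Implicit Types (x y z : 'I_3 -> C) (G : tensor C 3) (c : 'I_3 -> 'I_3 -> 'I_3 -> C).

(** The coefficients of [trisum c x x x] at x = (e0, e1, w) as a Laurent
    polynomial in signs e0, e1 and a phase w. *)
Definition sign_monomials0 c :=
  [/\ c 0 0 0 + c 0 1 1 + c 1 0 1 + c 1 1 0 + c 0 2 2 + c 2 0 2 = 0 /\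
      c 1 1 1 + c 1 0 0 + c 0 1 0 + c 0 0 1 + c 1 2 2 + c 2 1 2 = 0,
      c 2 0 0 + c 2 1 1 + c 0 2 0 + c 1 2 1 + c 2 2 2 = 0 /\
      c 2 0 1 + c 2 1 0 + c 0 2 1 + c 1 2 0 = 0,
      c 0 0 2 + c 1 1 2 = 0 /\ c 0 1 2 + c 1 0 2 = 0
    & c 2 2 0 = 0 /\ c 2 2 1 = 0].

Definition is_sign (e : C) := e = 1 \/ e = -1.

Lemma sign_torus_monomials0 c :
  (forall e w, is_sign e -> unim w ->
     trisum c (vec3 1 e w) (vec3 1 e w) (vec3 1 e w) = 0) ->
  sign_monomials0 c.
Proof.
move=> H.
have {}H e w : is_sign e -> unim w ->
  ((c 0 0 0 + c 0 1 1 + c 1 0 1 + c 1 1 0 + c 0 2 2 + c 2 0 2)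
   + (c 1 1 1 + c 1 0 0 + c 0 1 0 + c 0 0 1 + c 1 2 2 + c 2 1 2) * e)
  + ((c 2 0 0 + c 2 1 1 + c 0 2 0 + c 1 2 1 + c 2 2 2)
     + (c 2 0 1 + c 2 1 0 + c 0 2 1 + c 1 2 0) * e) * w
  + ((c 0 0 2 + c 1 1 2) + (c 0 1 2 + c 1 0 2) * e) * w^*
  + (c 2 2 0 + c 2 2 1 * e) * w ^+ 2 = 0.
  move=> es u; rewrite -[RHS](H _ _ es u) /trisum !sum3 /vec3 /= rmorph1.
  by case: es => ->; rewrite ?rmorphN ?rmorph1; ring: u.
have even_odd (a b : C) : (forall e, is_sign e -> a + b * e = 0) -> a = 0 /\ b = 0.
  move=> ab; have H1 := ab 1 (or_introl erefl); have H2 := ab (-1) (or_intror erefl).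
  have two : 2 != 0 :> C by rewrite pnatr_eq0.
  by split; apply: (mulfI two); rewrite mulr0;
    [lincomb (H1 +e H2)|lincomb (H1 +e -1 *e H2)].
have {}H e (es : is_sign e) := laurent0 (fun w u => H e w es u).
split; apply: even_odd => e es.
- by case: (H e es).
- by case: (H e es).
- by case: (H e es).
- by case: (H e es).
Qed.

Variables m n r : C.
Hypotheses (m0 : m != 0) (n0 : n != 0) (r0 : r != 0) (mn : m != n) (m1 : m ^+ 2 != 1).

(** The equations that the zeros (x ; y) impose on the rows of G.  In order they
    come from (1, e, w ; 1, e, w) with a sign e and a phase w, from
    (1, 0, 0 ; m, 1, 0), (1, n, 0 ; 0, 1, 0), (0, 0, 1 ; 1, 0, 0) and
    (0, 1, 0 ; 0, 0, 1), and from the derivative along the line of quartic contact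
    through the second one. *)
Definition row_relations G := forall i,
  [/\ sign_monomials0 (G i),
      m * G i 0 0 0 + G i 1 0 0 = 0,
      G i 1 0 0 + n * (G i 1 1 0 + G i 1 0 1) + n ^+ 2 * G i 1 1 1 = 0,
      G i 0 2 2 = 0 /\ G i 2 1 1 = 0
    & n * (m * (G i 0 1 0 - G i 0 0 1) + G i 1 1 0 - G i 1 0 1) + m * r * G i 0 0 0 = 0].

(** The equations from the same zeros with the two vectors exchanged. *)
Definition col_relations G := forall i,
  [/\ sign_monomials0 (G i),
      m ^+ 2 * G i 0 0 0 + m * (G i 0 0 1 + G i 0 1 0) + G i 0 1 1 = 0,
      G i 0 1 1 + n * G i 1 1 1 = 0,
      G i 2 0 0 = 0 /\ G i 1 2 2 = 0
    & n * (m ^+ 2 * G i 1 0 0 + m * (G i 1 0 1 + G i 1 1 0) + G i 1 1 1)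
      + m * r * (G i 0 0 1 - G i 0 1 0) = 0].
Definition mixed_relations G :=
  [/\ row_relations G, row_relations (conjT G),
      col_relations (swapT G) & col_relations (conjT (swapT G))].

Lemma mixed_conj G : mixed_relations G -> mixed_relations (conjT G).
Proof. by case. Qed.

(** The zeros are invariant under the phase of the third coordinate, so the
    system splits by weight, the number of positions j, k minus that of positions
    i, l at which the index is 2.  Here: the entries of weight 2 and -2, and those
    with exactly three indices 2. *)
Lemma mixed_weight2 G : mixed_relations G -> forall i,
  [/\ G i 2 2 0 = 0, G i 2 2 1 = 0, G 2 i 0 2 = 0 & G 2 i 1 2 = 0] /\
  [/\ G 2 0 i 2 = 0, G 2 1 i 2 = 0, G 0 2 2 i = 0 & G 1 2 2 i = 0].
Proof.
case=> g h s t i.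
have [[_ _ _ [g0 g1]] _ _ _ _] := g i; have [[_ _ _ [h0 h1]] _ _ _ _] := h i.
have [[_ _ _ [s0 s1]] _ _ _ _] := s i; have [[_ _ _ [t0 t1]] _ _ _ _] := t i.
by [].
Qed.

(** The entries whose only index 2 is the first or the last one, of weight -1;
    [mixed_conj] yields the other two positions. *)
Lemma mixed_weight1 G : mixed_relations G ->
  [/\ G 2 0 0 0 = 0, G 2 0 0 1 = 0, G 2 0 1 0 = 0 & G 2 0 1 1 = 0] /\
  [/\ G 2 1 0 0 = 0, G 2 1 0 1 = 0, G 2 1 1 0 = 0 & G 2 1 1 1 = 0] /\
  [/\ G 0 0 0 2 = 0, G 0 0 1 2 = 0, G 0 1 0 2 = 0 & G 0 1 1 2 = 0] /\
  [/\ G 1 0 0 2 = 0, G 1 0 1 2 = 0, G 1 1 0 2 = 0 & G 1 1 1 2 = 0].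
Proof.
move=> mG; have [_ [w2 _ _ _]] := mixed_weight2 mG 2; case: mG => g h s t.
rewrite /conjT in h t; rewrite /swapT in s t.
have [[_ [B0 B1] _ _] _ _ [_ e2011] _] := h 0.
have [_ _ _ [_ e2111] _] := h 1.
have [[_ _ [t00 t01] _] _ _ _ _] := t 0; have [[_ _ [t10 t11] _] _ _ _ _] := t 1.
have [[_ _ [g00 g01] _] _ _ _ _] := g 0; have [[_ _ [g10 g11] _] _ _ _ _] := g 1.
have [_ _ _ [e0002 _] _] := s 0; have [_ _ _ [e0012 _] _] := s 1.
have [_ z1 _ _ _] := g 2; have [_ z2 _ _ _] := t 2.
rewrite e2111 addr0 in t10; rewrite e2011 addr0 in t11.
rewrite e0002 add0r in g00; rewrite e0012 add0r in g01.
rewrite e2011 e0002 w2 !addr0 in B0; rewrite t10 e0012 !addr0 in B1.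
rewrite e0002 g01 !(mulr0, add0r, addr0) in z2.
have u0 : G 2 0 0 0 = 0.
  apply: (mulfI (_ : 1 - m ^+ 2 != 0)); first by rewrite subr_eq0 eq_sym.
  rewrite mulr0.
  by lincomb (B0 +e (-1) *e g11 +e z2 +e (- m) *e B1 +e m *e t01 +e (- m) *e z1).
rewrite u0 ?mulr0 ?add0r in z1 B0 t00.
rewrite z1 add0r in t01; rewrite t01 add0r in B1; rewrite B0 add0r in g11.
rewrite B1 add0r in g10.
by [].
Qed.

(** The entries of weight 0.  This is the only place where r != 0 and m != n
    are used: the derivative along the line of quartic contact is what ties
    G 1 0 1 0 to G 0 1 0 1. *)
Lemma mixed_weight0 G : mixed_relations G -> G 1 1 1 1 = 0 ->
  [/\ G 0 0 0 0 = 0, G 0 0 0 1 = 0, G 0 0 1 0 = 0 & G 0 0 1 1 = 0] /\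
  [/\ G 0 1 0 0 = 0, G 0 1 0 1 = 0, G 0 1 1 0 = 0 & G 0 1 1 1 = 0] /\
  [/\ G 1 0 0 0 = 0, G 1 0 0 1 = 0, G 1 0 1 0 = 0 & G 1 0 1 1 = 0] /\
  [/\ G 1 1 0 0 = 0, G 1 1 0 1 = 0 & G 1 1 1 0 = 0] /\
  [/\ G 2 2 0 0 = 0, G 1 1 2 2 = 0, G 0 2 0 2 = 0 & G 0 2 1 2 = 0] /\
  G 1 2 0 2 = 0 /\ G 1 2 1 2 = 0.
Proof.
case=> g h s t e1111; rewrite /conjT in h t; rewrite /swapT in s t.
have [[[g00 g01] _ _ _] y0 z0 [e0022 _] i0] := g 0.
have [[[g10 g11] _ _ _] y1 _ [e1022 _] i1] := g 1.
have [_ _ hz0 _ hi0] := h 0; have [_ hy1 _ [e0122 _] _] := h 1.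
have [[[s00 s01] _ _ _] _ sz0 [_ e2201] _] := s 0.
have [[[s10 s11] _ _ _] sy1 sz1 [_ e2211] si1] := s 1.
have [_ _ _ [_ e2210] _] := t 0.
have [_ _ tz1 _ ti1] := t 1.
have cancel (a b : C) : a != 0 -> a * b = 0 -> b = 0.
  by move=> a0 ab; apply: (mulfI a0); rewrite mulr0.
have two : 2 != 0 :> C by rewrite pnatr_eq0.
rewrite e1111 mulr0 addr0 in sz1; rewrite e1111 mulr0 addr0 in tz1.
rewrite tz1 mulr0 addr0 in sz0.
rewrite sz0 addr0 in y1; rewrite sz0 addr0 in hy1.
have e1000 := cancel _ _ m0 y1; have e0100 := cancel _ _ m0 hy1.
rewrite e0100 addr0 in y0; have e0000 := cancel _ _ m0 y0.
have beq : G 1 0 1 0 - G 1 0 0 1 = 0.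
  apply: (cancel (n * m)); first exact: mulf_neq0.
  by move: i1; rewrite sz1 tz1 e1000 => i1; lincomb i1.
have aeq : G 0 0 1 0 - G 0 0 0 1 = 0.
  apply: (cancel (n * m)); first exact: mulf_neq0.
  by move: hi0; rewrite e0000 => hi0; lincomb ((-1) *e hi0 +e (- n) *e beq).
have ceq : G 0 1 1 0 - G 0 1 0 1 = 0.
  apply: (cancel n) => //.
  by move: i0; rewrite e0000 => i0; lincomb (i0 +e (- n * m) *e aeq).
have bceq : G 1 0 1 0 - G 0 1 0 1 = 0.
  apply: (cancel (2 * m * r)); first by rewrite !mulf_neq0.
  by lincomb (ti1 +e (-1) *e si1 +e (m * r) *e beq +e (m * r) *e ceq).
have gE : G 1 0 1 1 - G 0 0 1 0 = 0.
  by move: s01 g10; rewrite tz1 e1000 e0100 e2201 sz1 e1022 => s01 g10;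
    lincomb (g10 +e (-1) *e s01 +e (-1) *e aeq).
have a2 : m * G 0 0 1 0 + 2 * G 1 0 1 0 = 0.
  apply: (cancel m) => //.
  by move: sy1; rewrite sz1 => sy1; lincomb (sy1 +e (- m) *e ceq +e m *e bceq).
have n2 : n * G 0 0 1 0 + 2 * G 1 0 1 0 = 0.
  apply: (cancel n) => //.
  by move: hz0; rewrite e1000 => hz0; lincomb (hz0 +e n *e beq +e (- n ^+ 2) *e gE).
have e0010 : G 0 0 1 0 = 0.
  apply: (cancel (m - n)); first by rewrite subr_eq0.
  by lincomb (a2 +e (-1) *e n2).
rewrite e0010 mulr0 add0r in n2; have e1010 := cancel _ _ two n2.
rewrite e0010 sub0r in aeq; move/eqP: aeq; rewrite oppr_eq0 => /eqP e0001.
rewrite e1010 sub0r in beq; move/eqP: beq; rewrite oppr_eq0 => /eqP e1001.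
rewrite e1010 sub0r in bceq; move/eqP: bceq; rewrite oppr_eq0 => /eqP e0101.
rewrite e0101 subr0 in ceq; rewrite e0010 subr0 in gE.
have e0111 : G 0 1 1 1 = 0.
  apply: (cancel (n ^+ 2)); first by rewrite expf_neq0.
  by move: z0; rewrite e0100 ceq e0101 => z0; lincomb z0.
have e0011 : G 0 0 1 1 = 0.
  apply: (cancel (n * m ^+ 2)); first by rewrite mulf_neq0 ?expf_neq0.
  by move: si1; rewrite e0111 gE e1111 ceq e1010 => si1; lincomb si1.
have e0202 : G 0 2 0 2 = 0.
  by move: g00; rewrite e0000 e0011 e0101 ceq e0022 => g00; lincomb g00.
have e0212 : G 0 2 1 2 = 0.
  by move: g01; rewrite e0111 e0100 e0010 e0001 e0122 => g01; lincomb g01.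
have e1202 : G 1 2 0 2 = 0.
  by move: g10; rewrite e1000 gE tz1 sz1 e1022 => g10; lincomb g10.
have e1212 : G 1 2 1 2 = 0.
  by move: s11; rewrite e1111 e0011 e1010 ceq e2211 => s11; lincomb s11.
have e1122 : G 1 1 2 2 = 0.
  by move: g11; rewrite e1111 sz0 e1010 e1001 e1212 => g11; lincomb g11.
have e2200 : G 2 2 0 0 = 0.
  by move: s00; rewrite e0000 sz0 e0101 e1001 e0202 => s00; lincomb s00.
by [].
Qed.

Lemma mixed_unique G : mixed_relations G -> G 1 1 1 1 = 0 ->
  forall i j k l, G i j k l = 0.
Proof.
move=> mG e1111; have cG := mixed_conj mG.
have [[? ? ? ?] [[? ? ? ?] [[? ? ? ?] [[? ? ?] [[? ? ? ?] [? ?]]]]]] := mixed_weight0 mG e1111.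
have [_ [_ [_ [_ [[_ _ S00 S01] [S10 S11]]]]]] := mixed_weight0 cG e1111.
have [[? ? ? ?] [[? ? ? ?] [[? ? ? ?] [? ? ? ?]]]] := mixed_weight1 mG.
have [c1 [c2 [c3 c4]]] := mixed_weight1 cG; rewrite /conjT in S00 S01 S10 S11 c1 c2 c3 c4.
case: c1 c2 c3 c4 => ? ? ? ? [? ? ? ?] [? ? ? ?] [? ? ? ?].
have W i := mixed_weight2 mG i.
have [[? ? ? ?] [? ? ? ?]] := W 0; have [[? ? ? ?] [? ? ? ?]] := W 1.
have [[? ? ? ?] [? ? ? ?]] := W 2.
have e : [/\ G 0 0 2 2 = 0, G 0 1 2 2 = 0, G 1 0 2 2 = 0, G 2 2 1 1 = 0 & G 2 2 0 1 = 0 /\ G 2 2 1 0 = 0].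
  case: mG => g h s t; rewrite /conjT in h t; rewrite /swapT in s t.
  have [_ _ _ [? _] _] := g 0; have [_ _ _ [? _] _] := g 1.
  have [_ _ _ [? _] _] := h 1; have [_ _ _ [_ ?] _] := s 1.
  by have [_ _ _ [_ ?] _] := s 0; have [_ _ _ [_ ?] _] := t 0.
have e2222 : G 2 2 2 2 = 0.
  case: mG => g _ _ _; have [[_ [+ _] _ _] _ _ _ _] := g 2.
  have -> : G 2 2 0 0 = 0 by [].
  have [_ _ _ -> _] := e; rewrite S00 S11 !add0r; exact.
by case: e => ? ? ? ? [? ?]; do 4 elim/I3_ind.
Qed.

End Mixed.

Section FlatMixed.
Variable C : numClosedFieldType.
Implicit Types (G : tensor C 3).

(** Conjugation turns the direction of the line of quartic contact, which is
    imaginary, into its opposite; hence the sign s in the two auxiliary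
    statements. *)
Lemma flat_mixed G (m n r : C) : m^* = m -> n^* = n -> r^* = r ->
  (forall e w, is_sign e -> unim w ->
     flat4 G (vec3 1 e w) (zv C) (vec3 1 e w) (zv C)) ->
  flat4 G (vec3 1 0 0) (vec3 0 ('i * n) 0) (vec3 m 1 0) (vec3 ('i * m * r) 0 0) ->
  flat4 G (vec3 1 n 0) (zv C) (vec3 0 1 0) (zv C) ->
  flat4 G (vec3 0 0 1) (zv C) (vec3 1 0 0) (zv C) ->
  flat4 G (vec3 0 1 0) (zv C) (vec3 0 0 1) (zv C) ->
  mixed_relations m n r G.
Proof.
move=> mr nr rr Hs [a1 a2 a3 a4] [b1 b2 b3 b4] [c1 c2 c3 c4] [d1 d2 d3 d4].
have i0 : 'i != 0 :> C := neq0Ci C.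
have ni0 : - 'i != 0 :> C by rewrite oppr_eq0.
have is_signC e : is_sign e -> e^* = e :> C.
  by case=> ->; rewrite ?rmorphN rmorph1.
have cV (e w : C) : is_sign e -> conjv (vec3 1 e w^*) =1 vec3 1 e w.
  by move=> es; elim/I3_ind; rewrite /conjv /vec3 /= ?rmorph1 ?conjCK ?(is_signC e es).
have S1 i : sign_monomials0 (G i).
  by apply: sign_torus_monomials0 => e w es u; have [/(_ i)[]] := Hs e w es u.
have S2 i : sign_monomials0 (conjT G i).
  apply: sign_torus_monomials0 => e w es u.
  have [_ /(_ i)[+ _] _ _] := Hs e _ es (unimC u).
  by rewrite (eq_rowsum _ _ (cV e w es) (cV e w es) (cV e w es)).
have S3 i : sign_monomials0 (swapT G i).
  apply: sign_torus_monomials0 => e w es u.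
  have [_ _ /(_ i)[+ _] _] := Hs e _ es (unimC u).
  by rewrite (eq_rowsum _ _ (cV e w es) (cV e w es) (cV e w es)).
have S4 i : sign_monomials0 (conjT (swapT G) i).
  by apply: sign_torus_monomials0 => e w es u; have [_ _ _ /(_ i)[]] := Hs e w es u.
have row H s (sE : s = 'i \/ s = - 'i) :
    flat H (vec3 1 0 0) (vec3 0 (s * n) 0) (vec3 m 1 0) (vec3 (s * m * r) 0 0) ->
    flat H (vec3 1 n 0) (zv C) (vec3 0 1 0) (zv C) ->
    flat H (vec3 0 0 1) (zv C) (vec3 1 0 0) (zv C) ->
    flat H (vec3 0 1 0) (zv C) (vec3 0 0 1) (zv C) ->
    (forall i, sign_monomials0 (H i)) -> row_relations m n r H.
  move=> fa fb fc fd S i; split; first exact: S.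
  - have [+ _] := fa i; rewrite /rowsum !sum3 /vec3 /= ?rmorph1 ?rmorph0 => E.
    by lincomb E.
  - have [+ _] := fb i; rewrite /rowsum !sum3 /vec3 /= ?rmorph1 ?rmorph0 ?nr => E.
    by lincomb E.
  - have [+ _] := fc i; have [+ _] := fd i.
    rewrite /rowsum !sum3 /vec3 /= ?rmorph1 ?rmorph0 => E E'.
    by split; [lincomb E'|lincomb E].
  - have [_ +] := fa i.
    rewrite /rowsum !sum3 /vec3 /= ?rmorph1 ?rmorph0 ?rmorphM /= ?nr => E.
    have s0 : s != 0 by case: sE => ->.
    have sC : s^* = - s by case: sE => ->; rewrite ?rmorphN /= conjCi ?opprK.
    apply: (mulfI s0); rewrite mulr0; move: E; rewrite sC => E.
    by lincomb E.
have col H s (sE : s = 'i \/ s = - 'i) :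
    flat H (vec3 m 1 0) (vec3 (s * m * r) 0 0) (vec3 1 0 0) (vec3 0 (s * n) 0) ->
    flat H (vec3 0 1 0) (zv C) (vec3 1 n 0) (zv C) ->
    flat H (vec3 1 0 0) (zv C) (vec3 0 0 1) (zv C) ->
    flat H (vec3 0 0 1) (zv C) (vec3 0 1 0) (zv C) ->
    (forall i, sign_monomials0 (H i)) -> col_relations m n r H.
  move=> fa fb fc fd S i; split; first exact: S.
  - have [+ _] := fa i; rewrite /rowsum !sum3 /vec3 /= ?rmorph1 ?rmorph0 ?mr => E.
    by lincomb E.
  - have [+ _] := fb i; rewrite /rowsum !sum3 /vec3 /= ?rmorph1 ?rmorph0 => E.
    by lincomb E.
  - have [+ _] := fc i; have [+ _] := fd i.
    rewrite /rowsum !sum3 /vec3 /= ?rmorph1 ?rmorph0 => E E'.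
    by split; [lincomb E'|lincomb E].
  - have [_ +] := fa i.
    rewrite /rowsum !sum3 /vec3 /= ?rmorph1 ?rmorph0 ?rmorphM /= ?mr ?rr => E.
    have s0 : s != 0 by case: sE => ->.
    have sC : s^* = - s by case: sE => ->; rewrite ?rmorphN /= conjCi ?opprK.
    apply: (mulfI s0); rewrite mulr0; move: E; rewrite sC => E.
    by lincomb E.
have cz : conjv (zv C) =1 zv C by move=> i; rewrite /conjv /zv rmorph0.
have k0 : conjv (vec3 1 0 0) =1 vec3 1 0 0 :> ('I_3 -> C).
  by elim/I3_ind; rewrite /conjv /vec3 /= ?rmorph0 ?rmorph1.
have k1 : conjv (vec3 0 1 0) =1 vec3 0 1 0 :> ('I_3 -> C).
  by elim/I3_ind; rewrite /conjv /vec3 /= ?rmorph0 ?rmorph1.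
have k2 : conjv (vec3 0 0 1) =1 vec3 0 0 1 :> ('I_3 -> C).
  by elim/I3_ind; rewrite /conjv /vec3 /= ?rmorph0 ?rmorph1.
have km : conjv (vec3 m 1 0) =1 vec3 m 1 0.
  by elim/I3_ind; rewrite /conjv /vec3 /= ?rmorph0 ?rmorph1 ?mr.
have kn : conjv (vec3 1 n 0) =1 vec3 1 n 0.
  by elim/I3_ind; rewrite /conjv /vec3 /= ?rmorph0 ?rmorph1 ?nr.
have kin : conjv (vec3 0 ('i * n) 0) =1 vec3 0 (- 'i * n) 0.
  by elim/I3_ind; rewrite /conjv /vec3 /= ?rmorph0 ?rmorphM /= ?conjCi ?nr.
have kim : conjv (vec3 ('i * m * r) 0 0) =1 vec3 (- 'i * m * r) 0 0.
  by elim/I3_ind; rewrite /conjv /vec3 /= ?rmorph0 ?rmorphM /= ?conjCi ?mr ?rr.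
split.
- by apply: (row _ 'i) => //; left.
- apply: (row _ (- 'i)); first by right.
  + exact: eq_flat a2.
  + exact: eq_flat b2.
  + exact: eq_flat c2.
  + exact: eq_flat d2.
  + by [].
- apply: (col _ (- 'i)); first by right.
  + exact: eq_flat a3.
  + exact: eq_flat b3.
  + exact: eq_flat c3.
  + exact: eq_flat d3.
  + by [].
- by apply: (col _ 'i) => //; left.
Qed.

End FlatMixed.

(** * The determinant of the third family *)

Section Cubic.
Variable R : realType.
Implicit Types (m n q th w N a b z : R).

(** With s = - m n and q = max(m^2, n^2) this is for a suitable z, up to a
    positive factor, the determinant of Phi3 (rk1 x), where N0, N1, w are the
    squared moduli of the entries of x and r is the real part of x 0 times the
    conjugate of x 1. *)
Definition mixed_cubic m n q z (N0 N1 w r : R) :=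
  let s := - (m * n) in
  (s ^+ 2 * N0 + 2 * m * s * r + m ^+ 2 * N1) * (w - N0) * (w - N1)
  + w * (n ^+ 2 * (w - N0) ^+ 2 + q * (w - N1) ^+ 2
         - (q + n ^+ 2) * (w - N0) * (w - N1))
  + (z * w - s ^+ 2 * N0) * (N0 * N1 - r ^+ 2).

(** For N0 = 1 the cubic is quadratic in r.  Moving a multiple of N1 - r^2 to
    the last term completes a square in r and leaves a quadratic polynomial in
    N1 with coefficients c, o, d.  The equation between w and th makes its
    discriminant factor. *)
Lemma mixed_cubicE m n q th z N1 w r :
  m != 0 -> n != 0 -> th != 0 -> 1 - q * th != 0 ->
  w * (1 - q * th) = m ^+ 2 * n ^+ 2 * th * (th - 1) ->
  let s := - (m * n) in
  let v := s ^+ 2 * th * (1 - w) ^+ 2 in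
  let d := m ^+ 2 + (q - m ^+ 2) * w - m ^+ 2 / th in
  let c := w * (n ^+ 2 - s ^+ 2 + (q - n ^+ 2 + s ^+ 2) * w) - m ^+ 2 / th * w ^+ 2 in
  let o := (s ^+ 2 - (q + m ^+ 2 + n ^+ 2 + s ^+ 2) * w
            + (m ^+ 2 + n ^+ 2 - q) * w ^+ 2 - v) / 2 + m ^+ 2 / th * w in
  let k := (1 - m ^+ 2 * th) * (1 - n ^+ 2 * th) / th in
  let p := (1 - q * th) / th in
  mixed_cubic m n q z 1 N1 w r =
    s ^+ 2 * th * ((1 - w) * r + m / (s * th) * (N1 - w)) ^+ 2
    + (c + 2 * o * N1 + d * N1 ^+ 2)
    + (v - s ^+ 2 + z * w) * (N1 - r ^+ 2) /\
  d * c - o ^+ 2 = (1 - w) ^+ 2 * w ^+ 2 * k * (4 * p - k) / 4.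
Proof.
move=> m0 n0 t0 qt wE /=.
have {wE} -> : w = m ^+ 2 * n ^+ 2 * th * (th - 1) / (1 - q * th).
  by apply: (mulIf qt); rewrite divfK.
split.
  by rewrite /mixed_cubic; field; rewrite qt t0 n0 m0.
by field; rewrite ?t0 ?qt.
Qed.

(** The polynomial s2 th (th - 1) - w (1 - q th) in th changes sign between 1
    and 1 / q. *)
Lemma mixed_root (s2 q w : R) : 0 < s2 -> 0 < q -> q < 1 -> 0 < w ->
  exists2 th, 1 < th & th * q < 1 /\ w * (1 - q * th) = s2 * th * (th - 1).
Proof.
move=> s20 q0 q1 w0.
pose f : {poly R} := s2 *: 'X^2 + (w * q - s2) *: 'X - w%:P.
have fE x : f.[x] = s2 * x * (x - 1) - w * (1 - q * x).
  by rewrite /f hornerD hornerN hornerD !hornerZ hornerXn hornerX hornerC; ring.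
have f1 : f.[1] < 0.
  by rewrite fE subrr mulr0 sub0r oppr_lt0 mulr1 mulr_gt0 // subr_gt0.
have fq : 0 < f.[q^-1].
  by rewrite fE mulfV ?gt_eqF // subrr mulr0 subr0 !mulr_gt0 ?invr_gt0 ?subr_gt0 ?invf_gt1.
have q1' : 1 <= q^-1 by rewrite ltW // invf_gt1.
have [|x /andP[x1 xq] /rootP fx] := @poly_ivt _ f 1 q^-1 q1'.
  by rewrite ltW //= ltW.
have xn1 : x != 1 by apply/eqP => x1E; rewrite x1E in fx; rewrite fx ltxx in f1.
have xnq : x != q^-1 by apply/eqP => xE; rewrite -xE fx ltxx in fq.
exists x; first by rewrite lt_neqAle eq_sym xn1.
split; first by rewrite -ltr_pdivlMr // mul1r lt_neqAle xnq.
by apply/eqP; rewrite eq_sym -subr_eq0 -fE fx.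
Qed.

(** All terms of [mixed_cubicE] are nonnegative for th between 1 and 1 / q.  The
    inequality k <= 4 p is where q has to be one of m^2, n^2. *)
Lemma mixed_cubic_ge0_normal m n q z N1 w r :
  m != 0 -> n != 0 -> 0 < q -> q < 1 -> m ^+ 2 <= q -> n ^+ 2 <= q ->
  (q - m ^+ 2) * (q - n ^+ 2) = 0 -> 2 * (m * n) ^+ 2 <= z ->
  0 < w -> r ^+ 2 <= N1 -> 0 <= mixed_cubic m n q z 1 N1 w r.
Proof.
move=> m0 n0 q0 q1 mq nq mn_q zs w0 rN.
have m20 : 0 < m ^+ 2 by rewrite exprn_even_gt0.
have n20 : 0 < n ^+ 2 by rewrite exprn_even_gt0.
have [|th th1 [thq wE]] := @mixed_root (m ^+ 2 * n ^+ 2) q w _ q0 q1 w0.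
  exact: mulr_gt0.
have th0 : 0 < th by apply: lt_trans th1.
have thn0 : th != 0 by rewrite gt_eqF.
have qth : 0 < 1 - q * th by rewrite subr_gt0 mulrC.
have qthn0 : 1 - q * th != 0 by rewrite gt_eqF.
pose s := - (m * n).
pose v := s ^+ 2 * th * (1 - w) ^+ 2.
pose d := m ^+ 2 + (q - m ^+ 2) * w - m ^+ 2 / th.
pose c := w * (n ^+ 2 - s ^+ 2 + (q - n ^+ 2 + s ^+ 2) * w) - m ^+ 2 / th * w ^+ 2.
pose o := (s ^+ 2 - (q + m ^+ 2 + n ^+ 2 + s ^+ 2) * w
            + (m ^+ 2 + n ^+ 2 - q) * w ^+ 2 - v) / 2 + m ^+ 2 / th * w.
pose k := (1 - m ^+ 2 * th) * (1 - n ^+ 2 * th) / th.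
pose p := (1 - q * th) / th.
have [-> dc] : mixed_cubic m n q z 1 N1 w r =
    s ^+ 2 * th * ((1 - w) * r + m / (s * th) * (N1 - w)) ^+ 2
    + (c + 2 * o * N1 + d * N1 ^+ 2) + (v - s ^+ 2 + z * w) * (N1 - r ^+ 2) /\
  d * c - o ^+ 2 = (1 - w) ^+ 2 * w ^+ 2 * k * (4 * p - k) / 4.
  exact: mixed_cubicE.
have mth : m ^+ 2 * th <= q * th by rewrite ler_pM2r.
have nth : n ^+ 2 * th <= q * th by rewrite ler_pM2r.
have m1 : 0 <= 1 - m ^+ 2 * th by lra.
have n1 : 0 <= 1 - n ^+ 2 * th by lra.
have k0 : 0 <= k by rewrite divr_ge0 ?mulr_ge0 // ltW.
have kp : k <= 4 * p.
  rewrite /k /p mulrA ler_pM2r ?invr_gt0 //.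
  have mt0 : 0 <= m ^+ 2 * th by rewrite mulr_ge0 // ltW.
  have nt0 : 0 <= n ^+ 2 * th by rewrite mulr_ge0 // ltW.
  move/eqP: mn_q; rewrite mulf_eq0 !subr_eq0 => /orP[] /eqP qE; rewrite -qE in qth *.
    have := mulr_ge0 (ltW qth) nt0; lra.
  have := mulr_ge0 (ltW qth) mt0; lra.
have d_gt0 : 0 < d.
  rewrite (_ : d = m ^+ 2 * (1 - th^-1) + (q - m ^+ 2) * w); last by rewrite /d; ring.
  rewrite ltr_pwDl ?mulr_ge0 ?subr_ge0 ?(ltW w0) //.
  by rewrite mulr_gt0 // subr_gt0 invf_lt1.
apply: addr_ge0; first apply: addr_ge0.
- by rewrite mulr_ge0 ?sqr_ge0 // mulr_ge0 ?sqr_ge0 // ltW.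
- rewrite -(pmulr_rge0 (c + 2 * o * N1 + d * N1 ^+ 2) d_gt0).
  rewrite (_ : d * (c + 2 * o * N1 + d * N1 ^+ 2) = (d * N1 + o) ^+ 2 + (d * c - o ^+ 2)); last by ring.
  rewrite addr_ge0 ?sqr_ge0 // dc divr_ge0 // mulr_ge0 ?subr_ge0 // mulr_ge0 //.
  by rewrite mulr_ge0 ?sqr_ge0.
apply: mulr_ge0; last by rewrite subr_ge0.
have s20 : 0 <= s ^+ 2 by rewrite sqr_ge0.
have zs' : 2 * s ^+ 2 <= z by rewrite /s sqrrN.
have h1 : 0 <= (z - 2 * s ^+ 2) * w by rewrite mulr_ge0 ?subr_ge0 // ltW.
have h2 : 0 <= s ^+ 2 * (1 - w) ^+ 2 * (th - 1).
  by rewrite mulr_ge0 ?subr_ge0 ?(ltW th1) // mulr_ge0 ?sqr_ge0.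
have h3 : 0 <= s ^+ 2 * w ^+ 2 by rewrite mulr_ge0 ?sqr_ge0.
rewrite (_ : v - s ^+ 2 + z * w = (z - 2 * s ^+ 2) * w + s ^+ 2 * (1 - w) ^+ 2 * (th - 1) + s ^+ 2 * w ^+ 2).
  by rewrite !addr_ge0.
by rewrite /v; ring.
Qed.

(** By homogeneity N0 = 1, except for the limiting cases N0 = 0 and w = 0. *)
Lemma mixed_cubic_ge0 m n q z N0 N1 w r :
  m != 0 -> n != 0 -> 0 < q -> q < 1 -> m ^+ 2 <= q -> n ^+ 2 <= q ->
  (q - m ^+ 2) * (q - n ^+ 2) = 0 -> 2 * (m * n) ^+ 2 <= z ->
  q <= m ^+ 2 + n ^+ 2 ->
  0 <= N0 -> 0 <= N1 -> 0 <= w -> r ^+ 2 <= N0 * N1 ->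
  0 <= mixed_cubic m n q z N0 N1 w r.
Proof.
move=> m0 n0 q0 q1 mq nq mn_q zs qe N00 N10 w0 rN.
have [N0z|N0n] := eqVneq N0 0.
  have r0 : r = 0.
    by apply/eqP; rewrite -sqrf_eq0 eq_le sqr_ge0 andbT (le_trans rN) // N0z mul0r.
  rewrite (_ : mixed_cubic _ _ _ _ _ _ _ _ = w * ((q - m ^+ 2) * N1 ^+ 2
     + (m ^+ 2 + n ^+ 2 - q) * w * N1)).
    by rewrite mulr_ge0 // addr_ge0 // mulr_ge0 ?sqr_ge0 ?subr_ge0 // mulr_ge0 ?subr_ge0.
  by rewrite /mixed_cubic N0z r0; ring.
have [wz|wn] := eqVneq w 0.
  rewrite (_ : mixed_cubic _ _ _ _ _ _ _ _ = N0 * (m * N1 - m * n * r) ^+ 2).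
    by rewrite mulr_ge0 ?sqr_ge0.
  by rewrite /mixed_cubic wz; ring.
have N0_gt0 : 0 < N0 by rewrite lt0r N0n.
have w_gt0 : 0 < w by rewrite lt0r wn.
rewrite (_ : mixed_cubic _ _ _ _ _ _ _ _ =
    N0 ^+ 3 * mixed_cubic m n q z 1 (N1 / N0) (w / N0) (r / N0)); last first.
  by rewrite /mixed_cubic; field.
apply: mulr_ge0; first by rewrite exprn_ge0.
apply: mixed_cubic_ge0_normal => //; first by rewrite divr_gt0.
rewrite expr_div_n ler_pdivrMr ?exprn_gt0 // (_ : N1 / N0 * N0 ^+ 2 = N0 * N1) //.
by field.
Qed.

End Cubic.

Section QuadForm.
Variable R : realType.

Lemma quadform2_ge0 (a d k N0 N1 r : R) : 0 <= a -> 0 <= d -> k ^+ 2 <= a * d ->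
  0 <= N0 -> 0 <= N1 -> r ^+ 2 <= N0 * N1 -> 0 <= a * N0 + 2 * k * r + d * N1.
Proof.
move=> a0 d0 kad N00 N10 rN.
have S0 : 0 <= a * N0 + d * N1 by rewrite addr_ge0 ?mulr_ge0.
have : (2 * k * r) ^+ 2 <= (a * N0 + d * N1) ^+ 2.
  rewrite (_ : (2 * k * r) ^+ 2 = 4 * (k ^+ 2 * r ^+ 2)); last by ring.
  apply: (@le_trans _ _ (4 * (a * d * (N0 * N1)))).
    by rewrite ler_pM2l // ler_pM ?sqr_ge0.
  rewrite -subr_ge0 (_ : _ - _ = (a * N0 - d * N1) ^+ 2) ?sqr_ge0 //; ring.
rewrite -ler_sqrt ?sqr_ge0 // !sqrtr_sqr (ger0_norm S0) ler_norml => /andP[+ _].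
by rewrite -subr_ge0; congr (0 <= _); ring.
Qed.

(** For p = min(m^2, n^2), q = max(m^2, n^2), s = - m n and tau = r + (1 - s).
    Since p <= s <= q, it is enough that 2 (q - s r) - s^2 >= q (1 - r)^2. *)
Lemma coef_bound (s q r p tau : R) : 0 < s -> s <= q -> 0 < q -> 0 < r ->
  q = 1 - r ^+ 2 -> p * q = s ^+ 2 -> r <= tau ->
  0 <= 2 * s * tau * r - (2 * tau + s) * (p * r ^+ 2).
Proof.
move=> s0 sq q0 r0 qE pq rt.
have [s_ge0 [q_ge0 r_ge0]] := (ltW s0, (ltW q0, ltW r0)).
have p0 : 0 <= p by rewrite -(pmulr_lge0 _ q0) pq sqr_ge0.
have sp : p <= s by rewrite -(ler_pM2r q0) pq expr2 ler_pM2l.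
have k0 : 0 <= 2 * s - 2 * p * r - s * p.
  rewrite -(pmulr_lge0 _ q0).
  rewrite (_ : _ * q = s * (2 * (q - s) * r + (q - s) * (q + s) + q * (1 - r) ^+ 2)).
    rewrite mulr_ge0 // !addr_ge0 ?(mulr_ge0 q_ge0 (sqr_ge0 _)) //.
      by rewrite !mulr_ge0 ?subr_ge0.
    by rewrite mulr_ge0 ?subr_ge0 ?addr_ge0.
  rewrite (_ : (2 * s - _ - _) * q = 2 * s * q - (2 * r + s) * (p * q)); last by ring.
  by rewrite pq qE; ring.
rewrite (_ : _ - _ = r * (2 * (tau - r) * (s - p * r) + r * (2 * s - 2 * p * r - s * p))); last by ring.
have pr_le : 0 <= s - p * r by have := mulr_ge0 s_ge0 p0; lra.
have rt' : 0 <= 2 * (tau - r) by lra.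
by rewrite mulr_ge0 // addr_ge0 // mulr_ge0.
Qed.

End QuadForm.

Section Params.
Variable R : realType.
Variables m n g : R.
Let s : R := - (m * n).
Let r : R := 1 - s + 2 * g.
Let q : R := 1 - r ^+ 2.
Let tau : R := r + (1 - s).
Hypotheses (m0 : m != 0) (s0 : 0 < s) (g0 : 0 < g)
  (mq : m ^+ 2 <= q) (nq : n ^+ 2 <= q) (mn_q : (q - m ^+ 2) * (q - n ^+ 2) = 0).

(** The coefficient of |x 2|^2 (N0 N1 - r^2) in the determinant of Phi3 (rk1 x),
    divided by 4 g^2. *)
Definition mixed_coef (m n g : R) :=
  let s := - (m * n) in let r := 1 - s + 2 * g in let t := r + (1 - s) in
  s ^+ 2 * t ^+ 2 + s * (s * t ^+ 2 + 2 * s * t * r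
    - (2 * t + s) * (4 * g * (1 - s + g) + (m + n) ^+ 2)).

Lemma param_q0 : 0 < q.
Proof. by apply: lt_le_trans mq; rewrite exprn_even_gt0. Qed.

Lemma param_sq : s <= q.
Proof.
rewrite -(@ler_sqr _ s) ?nnegrE ?(ltW s0) ?(ltW param_q0) //.
rewrite (_ : s ^+ 2 = m ^+ 2 * n ^+ 2); last by rewrite /s; ring.
by rewrite [X in _ <= X]expr2; apply: ler_pM; rewrite ?sqr_ge0.
Qed.

Lemma param_s1 : s <= 1.
Proof. by apply: le_trans param_sq _; rewrite /q lerBlDr lerDl sqr_ge0. Qed.

Lemma param_r_gt0 : 0 < r.
Proof. by rewrite /r ltr_wpDl ?subr_ge0 ?param_s1 // mulr_gt0. Qed.

(** One of m^2, n^2 is q, so the first factor is the other one. *)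
Lemma param_other : (m ^+ 2 + n ^+ 2 - q) * q = s ^+ 2.
Proof. by move: mn_q; rewrite /s; lra. Qed.

Lemma param_q_le : q <= m ^+ 2 + n ^+ 2.
Proof. by rewrite -subr_ge0 -(pmulr_lge0 _ param_q0) param_other sqr_ge0. Qed.

Lemma param_coef : 2 * (m * n) ^+ 2 * tau ^+ 2 <= mixed_coef m n g.
Proof.
rewrite -subr_ge0 (_ : _ - _ =
    s * (2 * s * tau * r - (2 * tau + s) * ((m ^+ 2 + n ^+ 2 - q) * r ^+ 2))).
  rewrite mulr_ge0 ?(ltW s0) //; apply: (@coef_bound _ s q r).
  - exact: s0.
  - exact: param_sq.
  - exact: param_q0.
  - exact: param_r_gt0.
  - by [].
  - exact: param_other.
  - by rewrite lerDl subr_ge0 param_s1.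
rewrite [X in _ * (_ - _ * X)](_ : _ = 4 * g * (1 - s + g) + (m + n) ^+ 2).
  by rewrite /mixed_coef -/s -/r -/tau /s; ring.
rewrite (_ : r ^+ 2 = 1 - q); last by rewrite /q; ring.
by rewrite mulrBr mulr1 param_other /q /r /s; ring.
Qed.

End Params.

(** * The third family *)

Section FamilyIII.
Variable R : realType.
Local Notation C := R[i]%C.
Local Open Scope complex_scope.
Implicit Types (m n b c g r : R) (x y : 'I_3 -> C).

Lemma Phi3_linear m n b c : linear (Phi3 m n b c).
Proof.
move=> k X Y; apply/matrixP; elim/I3_ind; elim/I3_ind;
  rewrite /Phi3 /mx3 !mxE /=; ring.
Qed.

(** The value y^H V x, where V is the matrix for which Phi3 m n 0 0 is the map
    Z |-> V Z V^H. *)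
Definition lform m n x y : C :=
  n%:C * (x 0 + m%:C * x 1) * (y 0)^* - m%:C * (n%:C * x 0 - x 1) * (y 1)^*
  - (m%:C + n%:C) * x 2 * (y 2)^*.

Lemma Phi3_biform m n b c x y :
  biform (tens (Phi3 m n b c)) x y =
    b%:C * (x 1 * (x 1)^* * (y 0 * (y 0)^*) + x 2 * (x 2)^* * (y 1 * (y 1)^*)
            + (x 0 * (x 0)^* + x 2 * (x 2)^*) * (y 2 * (y 2)^*)
            - (x 0 * (x 2)^* * ((y 0)^* * y 2) + x 2 * (x 0)^* * ((y 2)^* * y 0))
            - (x 1 * (x 2)^* * ((y 1)^* * y 2) + x 2 * (x 1)^* * ((y 2)^* * y 1)))
    + c%:C * ((x 0 * (x 1)^* - x 1 * (x 0)^*) * ((y 0)^* * y 1 - (y 1)^* * y 0))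
    + lform m n x y * (lform m n x y)^*.
Proof.
rewrite (biform_tens (Phi3_linear _ _ _ _)) /qform !sum3 /Phi3 /mx3 !mxE /=.
by rewrite /lform !rmorphB !rmorphM /= !conjCK !rmorphB !rmorphD !rmorphM /= !conjRC; ring.
Qed.

Lemma Phi3_ones m n b c (e w : C) : is_sign e -> unim w ->
  biform (tens (Phi3 m n b c)) (vec3 1 e w) (vec3 1 e w) = 0.
Proof.
move=> es u; have er : e^*%R = e by case: es => ->; rewrite ?rmorphN rmorph1.
have e2 : e * e = 1 by case: es => ->; ring.
rewrite Phi3_biform /lform /vec3 /= !rmorphB !rmorphM /= !rmorphB !rmorphD !rmorphM /=.
by rewrite !conjRC !conjCK !rmorph1 er; ring: u e2.
Qed.

Lemma Phi3_corners m n b c :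
  [/\ biform (tens (Phi3 m n b c)) (vec3 1 n%:C 0) (vec3 0 1 0) = 0,
      biform (tens (Phi3 m n b c)) (vec3 0 0 1) (vec3 1 0 0) = 0
    & biform (tens (Phi3 m n b c)) (vec3 0 1 0) (vec3 0 0 1) = 0].
Proof.
have E := Phi3_biform m n b c.
by split; rewrite E /lform /vec3 /= ?rmorph0 ?rmorph1; ring.
Qed.

(** The terms of degree 0, 1 and 3 in t vanish for all b and c; the two equations
    on b and c cancel the term of degree 2. *)
Lemma Phi3_curve m n b c r (t : C) : t^*%R = t ->
  b = r ^+ 2 - (1 + m * n) ^+ 2 -> 2 * c = m * n * (r - (1 + m * n)) ->
  biform (tens (Phi3 m n b c)) (line (vec3 1 0 0) (vec3 0 ('i * n%:C) 0) t)
    (line (vec3 m%:C 1 0) (vec3 ('i * m%:C * r%:C) 0 0) t)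
  = ((m * n * r) ^+ 2 * (b + (m * n) ^+ 2))%:C * t ^+ 4.
Proof.
move=> tr bE cE; have c2 : c%:C * 2 = (m * n * (r - (1 + m * n)))%:C.
  by rewrite -cE !rcE mulrC.
have i2 : 'i * 'i = -1 :> C by rewrite -expr2 sqrCi.
set l := n%:C * (1 + m%:C * (t * ('i * n%:C))) * (m%:C - t * ('i * m%:C * r%:C))
         - m%:C * (n%:C - t * ('i * n%:C)).
have lE : l = - (m%:C * n%:C * t * (r%:C * m%:C * n%:C * (-1) * t
              + (r%:C - 1 - m%:C * n%:C) * 'i)).
  by rewrite /l; ring: i2.
have lC : l^*%R = - (m%:C * n%:C * t * (r%:C * m%:C * n%:C * (-1) * t
              - (r%:C - 1 - m%:C * n%:C) * 'i)).
  rewrite lE; do 4 rewrite ?(rmorphN, rmorphB, rmorphM, rmorphD) /=.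
  by rewrite !conjRC ?conjCi ?tr ?rmorph1; ring.
have -> : biform (tens (Phi3 m n b c)) (line (vec3 1 0 0) (vec3 0 ('i * n%:C) 0) t)
    (line (vec3 m%:C 1 0) (vec3 ('i * m%:C * r%:C) 0 0) t) =
    b%:C * (n%:C ^+ 2 * t ^+ 2 * (m%:C ^+ 2 * (1 + r%:C ^+ 2 * t ^+ 2)))
    - (c%:C * 2) * 2 * (m%:C * n%:C * r%:C * t ^+ 2) + l * l^*.
  rewrite Phi3_biform.
  have -> : lform m n (line (vec3 1 0 0) (vec3 0 ('i * n%:C) 0) t)
      (line (vec3 m%:C 1 0) (vec3 ('i * m%:C * r%:C) 0 0) t) = l.
    rewrite /lform /l /line /vec3 /= !(rmorphD, rmorphM, rmorph0, rmorph1) /=.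
    by do 2 rewrite ?(rmorphM, rmorph0, rmorph1) /=; rewrite !conjRC conjCi tr; ring.
  congr (_ + _); move: (l * l^*) => _ {lE lC}.
  rewrite /line /vec3 /= !mulr0 !addr0 !add0r.
  do 3 rewrite ?(rmorphD, rmorphM, rmorph0, rmorph1) /=; rewrite !conjRC !conjCi !tr.
  by ring: i2.
by rewrite c2 lC lE bE !rcE; ring: i2.
Qed.

Lemma Phi3_rk1_herm m n b c x i j :
  Phi3 m n b c (rk1 x) i j = (Phi3 m n b c (rk1 x) j i)^*%R.
Proof.
elim/I3_ind: i; elim/I3_ind: j; rewrite /Phi3 /mx3 !mxE /=;
  do 5 rewrite ?(rmorphD, rmorphB, rmorphM, rmorphN, rmorphXn, rmorph0) /=;
  rewrite ?conjRC ?conjCK; ring.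
Qed.

Definition recross x : R := complex.Re (x 0 * (x 1)^*%R).

Lemma recrossE x : (recross x)%:C = (x 0 * (x 1)^*%R + x 1 * (x 0)^*%R) / 2.
Proof.
have -> : x 1 * (x 0)^*%R = (x 0 * (x 1)^*)^*%R by rewrite rmorphM /= conjCK mulrC.
rewrite /recross; case: (_ * _) => u v; apply/eqP; rewrite eq_complex /=.
by apply/andP; split; apply/eqP; field.
Qed.

Lemma recross_le x : recross x ^+ 2 <= sqn (x 0) * sqn (x 1).
Proof.
have -> : sqn (x 0) * sqn (x 1) = sqn (x 0 * (x 1)^*%R).
  apply: (@complexI R); rewrite rcM -!sqnE rmorphM /= conjCK; ring.
by rewrite /sqn lerDl sqr_ge0.
Qed.

Lemma Phi3_diag m n b c x :
  let N k := sqn (x k) in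
  [/\ Phi3 m n b c (rk1 x) 0 0 =
        (b * N 1 + n ^+ 2 * (N 0 + 2 * m * recross x + m ^+ 2 * N 1))%:C,
      Phi3 m n b c (rk1 x) 1 1 =
        (b * N 2 + m ^+ 2 * (n ^+ 2 * N 0 - 2 * n * recross x + N 1))%:C
    & Phi3 m n b c (rk1 x) 2 2 = (b * (N 0 + N 2) + (m + n) ^+ 2 * N 2)%:C].
Proof.
by move=> N; split; rewrite /Phi3 /mx3 !mxE /= /N !(=^~ sqnE, recrossE, rcE); field.
Qed.

(** The constant g = (r - (1 - s)) / 2 measures the slack in b >= 0 and makes b
    and c polynomial: b = r^2 - (1 - s)^2 = 4 g (1 - s + g) and c = - s g. *)
Lemma Phi3_minors m n g x :
  let s := - (m * n) in let q := 1 - (1 - s + 2 * g) ^+ 2 in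
  let b := 4 * g * (1 - s + g) in
  let A := Phi3 m n b (- (s * g)) (rk1 x) in
  let N k := sqn (x k) in let r := recross x in
  let v := n ^+ 2 * (N 0 + 2 * m * r + m ^+ 2 * N 1) in
  A 0 0 * A 1 1 - A 0 1 * A 1 0
    = (b * ((m * N 1 + s * r) ^+ 2 + N 2 * (b * N 1 + v)))%:C /\
  A 0 0 * A 2 2 - A 0 2 * A 2 0
    = (b * (b * N 0 * N 1 + v * N 0
       + N 2 * ((q - n ^+ 2 + s ^+ 2) * N 0 + 2 * (m * s) * r
                + (m ^+ 2 - q + n ^+ 2) * N 1)))%:C.
Proof.
by move=> s q b A N r v; split; rewrite /A /Phi3 /mx3 !mxE /= /v /r /N /b /q /s
  !(=^~ sqnE, recrossE, rcE); field.
Qed.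

Lemma Phi3_det m n g x :
  let s := - (m * n) in let r := 1 - s + 2 * g in let t := r + (1 - s) in
  let N k := sqn (x k) in
  det3 (Phi3 m n (4 * g * (1 - s + g)) (- (s * g)) (rk1 x)) =
  (4 * g ^+ 2 * (t ^+ 2 * mixed_cubic m n (1 - r ^+ 2) 0 (N 0) (N 1) (N 2) (recross x)
     + mixed_coef m n g * N 2 * (N 0 * N 1 - recross x ^+ 2)))%:C.
Proof.
move=> s r t N; rewrite /det3 /Phi3 /mx3 !mxE /= /mixed_cubic /mixed_coef /N /t /r /s !(=^~ sqnE, recrossE, rcE).
by field.
Qed.

Lemma Phi3_positive0 m n : positive_map (Phi3 m n 0 0).
Proof.
apply/(positive_map_biform (@Phi3_linear m n 0 0)) => x y.
by rewrite Phi3_biform !rc0 !mul0r !add0r mul_conjC_ge0.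
Qed.

Lemma Phi3_positive_pos m n g :
  let s := - (m * n) in let r := 1 - s + 2 * g in let q := 1 - r ^+ 2 in
  m != 0 -> n != 0 -> 0 < s -> 0 < g -> m ^+ 2 <= q -> n ^+ 2 <= q ->
  (q - m ^+ 2) * (q - n ^+ 2) = 0 ->
  positive_map (Phi3 m n (4 * g * (1 - s + g)) (- (s * g))).
Proof.
move=> s r q m0 n0 s0 g0 mq nq mn_q.
have q0 : 0 < q := @param_q0 R m n g m0 mq.
have s1 : s <= 1 := @param_s1 R m n g m0 s0 mq nq.
have r0 : 0 < r := @param_r_gt0 R m n g m0 s0 g0 mq nq.
have qle : q <= m ^+ 2 + n ^+ 2 := @param_q_le R m n g m0 mq mn_q.
have zs := @param_coef R m n g m0 s0 g0 mq nq mn_q.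
have q1 : q < 1 by rewrite ltrBlDr ltrDl exprn_gt0.
pose b := 4 * g * (1 - s + g).
have b0 : 0 < b by rewrite !mulr_gt0 // ltr_wpDl // subr_ge0.
have t0 : 0 < r + (1 - s) by rewrite ltr_pwDl ?subr_ge0.
apply/(positive_map_biform (@Phi3_linear _ _ _ _)) => x y.
rewrite biform_tens; last exact: Phi3_linear.
pose N k := sqn (x k); have N0 k : 0 <= N k := sqn_ge0 _.
have rN : recross x ^+ 2 <= N 0 * N 1 := recross_le x.
have [d0 d1 d2] := Phi3_diag m n b (- (s * g)) x; rewrite -!/(N _) in d0 d1 d2.
have [m01 m02] := Phi3_minors m n g x; rewrite -/s -/r -/q -/b -!/(N _) in m01 m02.
have dt := Phi3_det m n g x; cbv zeta in dt; rewrite -/s -/r -/q -!/(N _) in dt.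
have v0 : 0 <= n ^+ 2 * (N 0 + 2 * m * recross x + m ^+ 2 * N 1).
  rewrite mulr_ge0 ?sqr_ge0 // -[N 0]mul1r.
  by apply: quadform2_ge0; rewrite ?sqr_ge0 // mul1r.
move: y; apply: herm3P.
- by move=> i j; exact: Phi3_rk1_herm.
- by rewrite d0 ler0c addr_ge0 // mulr_ge0 // ltW.
- rewrite d1 ler0c; apply: addr_ge0; first by rewrite mulr_ge0 // ltW.
  rewrite mulr_ge0 ?sqr_ge0 //.
  rewrite (_ : _ - _ + _ = n ^+ 2 * N 0 + 2 * (- n) * recross x + 1 * N 1); last by ring.
  by apply: quadform2_ge0; rewrite ?sqr_ge0 // sqrrN mulr1.
- rewrite d2 ler0c; apply: addr_ge0; first by rewrite mulr_ge0 ?(ltW b0) // addr_ge0.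
  by rewrite mulr_ge0 ?sqr_ge0.
- rewrite m01 ler0c mulr_ge0 ?(ltW b0) // addr_ge0 ?sqr_ge0 // mulr_ge0 // addr_ge0 //.
  by rewrite mulr_ge0 // ltW.
- rewrite m02 ler0c mulr_ge0 ?(ltW b0) //; apply: addr_ge0.
    by apply: addr_ge0; rewrite mulr_ge0 // mulr_ge0 // ltW.
  rewrite mulr_ge0 //.
  have qmn : 0 <= q - n ^+ 2 by rewrite subr_ge0.
  have qmm : 0 <= m ^+ 2 - q + n ^+ 2 by rewrite -subr_ge0 in qle; lra.
  apply: quadform2_ge0 => //; first by rewrite addr_ge0 ?sqr_ge0.
  move/eqP: mn_q; rewrite mulf_eq0 !subr_eq0 => /orP[] /eqP qE; rewrite qE.
    rewrite -subr_ge0 (_ : _ - _ = n ^+ 2 * ((1 - m ^+ 2) * (m ^+ 2 - n ^+ 2))).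
      by rewrite mulr_ge0 ?sqr_ge0 // mulr_ge0 // ?subr_ge0 -qE // ltW.
    by rewrite /s; ring.
  by rewrite [X in _ <= X](_ : _ = (m * s) ^+ 2) //; ring.
- rewrite d0 => /(@complexI R) /eqP.
  have bN : 0 <= b * N 1 by rewrite mulr_ge0 // ltW.
  rewrite paddr_eq0 // mulf_eq0 gt_eqF //= => /andP[/eqP N1 /eqP v].
  have r2 : recross x = 0.
    by apply/eqP; rewrite -sqrf_eq0 eq_le sqr_ge0 andbT (le_trans rN) // N1 mulr0.
  have x1 : x 1 = 0.
    by apply/eqP; rewrite -normr_eq0 -sqrf_eq0 normCK sqnE -/(N 1) N1 rc0.
  have x0 : x 0 = 0.
    apply/eqP; rewrite -normr_eq0 -sqrf_eq0 normCK sqnE -/(N 0).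
    move: v; rewrite N1 r2 !mulr0 !addr0 => /eqP.
    by rewrite mulf_eq0 expf_eq0 /= (negPf n0) => /eqP ->; rewrite rc0.
  rewrite d1 d2 N1 r2 -[N 0]/(sqn (x 0)).
  have -> : sqn (x 0) = 0 by apply: (@complexI R); rewrite -sqnE x0 mul0r rc0.
  have -> : Phi3 m n b (- (s * g)) (rk1 x) 1 2 = 0.
    by rewrite /Phi3 /mx3 !mxE /= x0 x1; ring.
  rewrite mul0r subr0 !(mulr0, oppr0, subr0, add0r, addr0) -rcM ler0c.
  have bN2 : 0 <= b * N 2 by rewrite mulr_ge0 // ltW.
  by rewrite mulr_ge0 // addr_ge0 // mulr_ge0 ?sqr_ge0.
have t2 : 0 < (r + (1 - s)) ^+ 2 by rewrite exprn_gt0.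
rewrite dt ler0c; apply: mulr_ge0; first by rewrite mulr_ge0 ?sqr_ge0.
rewrite (_ : _ + _ = (r + (1 - s)) ^+ 2 * mixed_cubic m n q
   (mixed_coef m n g / (r + (1 - s)) ^+ 2) (N 0) (N 1) (N 2) (recross x)).
  rewrite mulr_ge0 ?(ltW t2) //; apply: mixed_cubic_ge0 => //.
  by rewrite ler_pdivlMr.
by rewrite /mixed_cubic; field; rewrite gt_eqF.
Qed.

Lemma Phi3_index m n b c : m != 0 -> tens (Phi3 m n b c) 1 1 1 1 != 0 :> C.
Proof.
move=> m0; rewrite /tens /Phi3 /mx3 !mxE /= !(mulr0, oppr0, add0r, mulr1).
by rewrite expf_neq0 // -rc0 (inj_eq (@complexI R)).
Qed.

Lemma Phi3_extremal_gt0 m n b c r : positive_map (Phi3 m n b c) ->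
  m != 0 -> n != 0 -> r != 0 -> m != n -> m ^+ 2 != 1 ->
  b = r ^+ 2 - (1 + m * n) ^+ 2 -> 2 * c = m * n * (r - (1 + m * n)) ->
  extremal_positive_map (Phi3 m n b c).
Proof.
move=> pf m0 n0 r0 mn m1 bE cE.
apply: (extremal_of_flat pf (Phi3_index n b c m0)) => G HG G1.
have HZ := flat_zero HG; have inj := inj_eq (@complexI R).
have [k1 k2 k3] := Phi3_corners m n b c.
apply: (@mixed_unique _ m%:C n%:C r%:C) G1; rewrite -?rcX -?rc1 -?rc0 ?inj //.
apply: flat_mixed; rewrite ?conjRC //.
- by move=> e w es u; apply/HZ/Phi3_ones.
- apply: HG => t /andP[t0 _]; apply: Phi3_curve => //.
  by apply: conj_Creal; apply: gtr0_real.
- exact: HZ.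
- exact: HZ.
- exact: HZ.
Qed.

(** The form is the product of |x 0 + m x 1|^2 and |y 1 - m y 0|^2, so each
    vector may be arbitrary if the other lies on a plane.  By [rowsum_eq0] the
    tensor is then determined by the entry (1, 1, 1, 1). *)
Lemma Phi3_extremal_rank1 m : m ^+ 2 = 1 -> extremal_positive_map (Phi3 m (- m) 0 0).
Proof.
move=> m2; have m0 : m != 0 by rewrite -sqrf_eq0 m2 oner_neq0.
apply: (extremal_of_flat (Phi3_positive0 _ _) (Phi3_index _ _ _ m0)) => G HG G1.
have HZ := flat_zero HG; have mc2 : m%:C ^+ 2 = 1 by rewrite -rcX m2.
have F0 x y : (x 0 + m%:C * x 1) * ((y 1)^* - m%:C * (y 0)^*) = 0 ->
    flat4 G x (zv C) y (zv C).
  move=> xy; apply: HZ; rewrite Phi3_biform !rc0 !mul0r !add0r.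
  rewrite (_ : lform _ _ _ _ = (x 0 + m%:C * x 1) * ((y 1)^* - m%:C * (y 0)^*)).
    by rewrite xy mul0r.
  by rewrite /lform rcN; ring: mc2.
have cK x : conjv (conjv x) =1 x := @conjvK _ _ x.
have FY y : (y 1)^*%R - m%:C * (y 0)^*%R = 0 ->
  (forall i k l, \sum_j G i j k l * y j = 0) /\
  (forall i k l, \sum_j G j i k l * (y j)^* = 0).
  move=> y0; have F x : flat4 G x (zv C) y (zv C) by apply: F0; rewrite y0 mulr0.
  split; first by apply: rowsum_eq0 => x i; have [/(_ i)[]] := F x.
  move=> i k l; have := @rowsum_eq0 _ _ (conjT G) (conjv y).
  move=> H; apply: (H _ i l k) => x j; have [_ /(_ j)[+ _] _ _] := F (conjv x).
  by rewrite (eq_rowsum _ _ (fun=> erefl) (cK x) (cK x)).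
have FX x : x 0 + m%:C * x 1 = 0 ->
  (forall i j k, \sum_l G i j k l * (x l)^* = 0) /\
  (forall i j l, \sum_k G i j k l * x k = 0).
  move=> x0; have F y : flat4 G x (zv C) y (zv C) by apply: F0; rewrite x0 mul0r.
  split.
    move=> i j k; have := @rowsum_eq0 _ _ (swapT G) (conjv x).
    move=> H; apply: (H _ k i j) => y a; have [_ _ /(_ a)[+ _] _] := F (conjv y).
    by rewrite (eq_rowsum _ _ (fun=> erefl) (cK y) (cK y)).
  move=> i j l; have := @rowsum_eq0 _ _ (conjT (swapT G)) x.
  by move=> H; apply: (H _ l j i) => y a; have [_ _ _ /(_ a)[]] := F y.
have [y21 y22] : (forall i k l, G i 2 k l = 0) /\ (forall i k l, G 2 i k l = 0).
  have [|a b] := FY (vec3 0 0 1); first by rewrite /vec3 /= rmorph0; ring.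
  by split=> i k l; [have := a i k l|have := b i k l];
    rewrite sum3 /vec3 /= ?rmorph0 ?rmorph1 !mulr0 mulr1 !add0r.
have [x21 x22] : (forall i j k, G i j k 2 = 0) /\ (forall i j k, G i j 2 k = 0).
  have [|a b] := FX (vec3 0 0 1); first by rewrite /vec3 /=; ring.
  by split=> i k l; [have := a i k l|have := b i k l];
    rewrite sum3 /vec3 /= ?rmorph0 ?rmorph1 !mulr0 mulr1 !add0r.
have [y1 y2] : (forall i k l, G i 0 k l = - m%:C * G i 1 k l) /\
    (forall i k l, G 0 i k l = - m%:C * G 1 i k l).
  have [|a b] := FY (vec3 1 m%:C 0).
    by rewrite /vec3 /= rmorph1 conjRC; ring.
  by split=> i k l; [have := a i k l|have := b i k l];
    rewrite sum3 /vec3 /= ?rmorph0 ?rmorph1 ?conjRC => E;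
    apply/eqP; rewrite -subr_eq0; apply/eqP; lincomb E.
have [x1 x2] : (forall i j k, G i j k 0 = m%:C * G i j k 1) /\
    (forall i j k, G i j 0 k = m%:C * G i j 1 k).
  have [|a b] := FX (vec3 m%:C (-1) 0); first by rewrite /vec3 /=; ring.
  by split=> i k l; [have := a i k l|have := b i k l];
    rewrite sum3 /vec3 /= ?rmorph0 ?rmorphN ?rmorph1 ?conjRC => E;
    apply: (mulfI (_ : m%:C != 0)); rewrite -?rc0 ?(inj_eq (@complexI R)) //;
    apply/eqP; rewrite -subr_eq0; apply/eqP; rewrite -[RHS]E; ring: mc2.
by do 4 elim/I3_ind; rewrite ?(y21, y22, x21, x22) // ?y1 ?y2 ?x1 ?x2 G1 !mulr0.
Qed.

(** The condition b >= 0 says 1 + m n <= r.  If r = 0, then m n = -1 and the map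
    has rank one; if r = 1 + m n, then b = c = 0 and positivity is clear. *)
Lemma Phi3_extremal_param m n r b c :
  let q := 1 - r ^+ 2 in
  m != 0 -> n != 0 -> m * n < 0 -> 0 <= r -> m ^+ 2 <= q -> n ^+ 2 <= q ->
  (q - m ^+ 2) * (q - n ^+ 2) = 0 ->
  b = r ^+ 2 - (1 + m * n) ^+ 2 -> 2 * c = m * n * (r - (1 + m * n)) -> 0 <= b ->
  extremal_positive_map (Phi3 m n b c).
Proof.
move=> q m0 n0 mn0 r0 mq nq mn_q bE cE b0.
have s0 : 0 < - (m * n) by rewrite oppr_gt0.
have s1 : 0 <= 1 + m * n.
  have : - (m * n) <= 1.
    rewrite -(@ler_sqr _ (- (m * n)) 1) ?nnegrE ?(ltW s0) // sqrrN exprMn expr1n.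
    have q1 : q <= 1 by rewrite lerBlDr lerDl sqr_ge0.
    by rewrite mulr_ile1 ?sqr_ge0 ?(le_trans mq) ?(le_trans nq).
  by lra.
have sr : 1 + m * n <= r by rewrite -ler_sqr ?nnegrE // -subr_ge0 -bE.
have m2 : m != n.
  by apply: contraTneq mn0 => ->; rewrite -leNgt -expr2 sqr_ge0.
have [rz|rn0] := eqVneq r 0.
  have mn1 : m * n = -1 by apply/eqP; rewrite -addr_eq0 addrC eq_le s1 -rz sr.
  have q1 : q = 1 by rewrite /q rz; ring.
  have mn2 : m ^+ 2 * n ^+ 2 = 1 by rewrite -exprMn mn1 sqrrN expr1n.
  have m1 : m ^+ 2 = 1.
    by apply: le_anti; rewrite -{1}q1 mq /= -mn2 ler_piMr ?sqr_ge0 // -q1.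
  have -> : n = - m by rewrite -[n]mul1r -m1 expr2 -mulrA mn1 mulrN1.
  have -> : b = 0 by rewrite bE rz mn1; ring.
  have -> : c = 0 by move: cE; rewrite rz mn1; lra.
  exact: Phi3_extremal_rank1.
have r_gt0 : 0 < r by rewrite lt_neqAle eq_sym rn0.
apply: (@Phi3_extremal_gt0 m n b c r) => //; last first.
  by rewrite lt_eqF // (le_lt_trans mq) // ltrBlDr ltrDl exprn_gt0.
have [rE|rE] := eqVneq r (1 + m * n).
  have -> : b = 0 by rewrite bE rE subrr.
  have -> : c = 0 by move: cE; rewrite rE subrr mulr0; lra.
  exact: Phi3_positive0.
pose g := (r - (1 + m * n)) / 2.
have g0 : 0 < g by rewrite divr_gt0 // subr_gt0 lt_neqAle eq_sym rE.
have rg : 1 - - (m * n) + 2 * g = r by rewrite /g; field.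
have -> : b = 4 * g * (1 - - (m * n) + g) by rewrite bE /g; field.
have -> : c = - (- (m * n) * g) by apply: (mulfI (_ : 2 != 0)); rewrite ?pnatr_eq0 // cE /g; field.
by apply: Phi3_positive_pos; rewrite ?rg.
Qed.

(** If m n >= 0, then b >= 0 would give m = n = 0.  Both the minimum and the
    maximum select the larger of m^2 and n^2. *)
Lemma Phi3_extremal m n :
  -1 <= m <= 1 -> -1 <= n <= 1 -> (m, n) != (0, 0) ->
  let b := Num.min (- 2 * m * n - m ^+ 2 * n ^+ 2 - n ^+ 2)
                   (- 2 * m * n - m ^+ 2 * n ^+ 2 - m ^+ 2) in
  let c := Num.max
    (- (1 / 2) * m * n * (1 + m * n - Num.sqrt (1 - m ^+ 2)))
    (- (1 / 2) * m * n * (1 + m * n - Num.sqrt (1 - n ^+ 2))) in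
  0 <= b -> extremal_positive_map (Phi3 m n b c).
Proof.
move=> m1 n1 mn b c b0; have /andP[b1 b2] : (0 <= - 2 * m * n - m ^+ 2 * n ^+ 2 - n ^+ 2)
   && (0 <= - 2 * m * n - m ^+ 2 * n ^+ 2 - m ^+ 2) by rewrite -le_min.
have sq1 (x : R) : -1 <= x <= 1 -> 0 <= 1 - x ^+ 2.
  move=> /andP[x0 x1]; rewrite (_ : _ - _ = (1 - x) * (1 + x)); last by ring.
  by rewrite mulr_ge0 //; lra.
have mn0 : m * n < 0.
  rewrite ltNge; apply: contra mn => mn_ge0.
  have := sqr_ge0 (m * n); rewrite exprMn => mn2.
  have m0 : m ^+ 2 <= 0 by lra.
  have n0 : n ^+ 2 <= 0 by lra.
  apply/eqP; congr (_, _); apply/eqP; rewrite -sqrf_eq0 eq_le sqr_ge0 andbT //.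
have [m0 n0] : m != 0 /\ n != 0.
  by split; apply: contraTneq mn0 => ->; rewrite ?mulr0 ?mul0r ltxx.
have k0 : 0 <= - (1 / 2) * m * n by lra.
have sq (x : R) : -1 <= x <= 1 -> 1 - Num.sqrt (1 - x ^+ 2) ^+ 2 = x ^+ 2 :> R.
  by move=> /sq1 x1; rewrite sqr_sqrtr //; ring.
have [mln|nlm] := leP (m ^+ 2) (n ^+ 2).
  apply: (@Phi3_extremal_param _ _ (Num.sqrt (1 - n ^+ 2))); rewrite ?sq ?sqrtr_ge0 //.
  - by rewrite subrr mulr0.
  - rewrite /b min_l; last by lra.
    by rewrite sqr_sqrtr ?sq1 //; ring.
  - rewrite /c max_r; first by field.
    by rewrite ler_wpM2l // lerD2l lerN2 ler_wsqrtr // lerD2l lerN2.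
apply: (@Phi3_extremal_param _ _ (Num.sqrt (1 - m ^+ 2))); rewrite ?sq ?sqrtr_ge0 ?(ltW nlm) //.
- by rewrite subrr mul0r.
- rewrite /b min_r; last by lra.
  by rewrite sqr_sqrtr ?sq1 //; ring.
- rewrite /c max_l; first by field.
  by rewrite ler_wpM2l // lerD2l lerN2 ler_wsqrtr // lerD2l lerN2 ltW.
Qed.

End FamilyIII.

Theorem proposition9 (R : realType) :
  [/\ (forall t : R, t != 1 -> t != -1 -> extremal_positive_map (Phi1 t)),
      (forall p q : R,
         0 <= p <= 1 / Num.sqrt 2 -> 0 <= q <= Num.sqrt 2 ->
         0 <= 2 * p - q ->
         0 <= (p ^+ 2 - 1) ^+ 2 * q ^+ 2 - p ^+ 2 ->
         (p, q) != (0, 0) -> (p, q) != (1 / Num.sqrt 2, Num.sqrt 2) ->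
         extremal_positive_map (Phi2 p q))
    & (forall m n : R,
         -1 <= m <= 1 -> -1 <= n <= 1 -> (m, n) != (0, 0) ->
         let b := Num.min (- 2 * m * n - m ^+ 2 * n ^+ 2 - n ^+ 2)
                          (- 2 * m * n - m ^+ 2 * n ^+ 2 - m ^+ 2) in
         let c := Num.max
           (- (1 / 2) * m * n * (1 + m * n - Num.sqrt (1 - m ^+ 2)))
           (- (1 / 2) * m * n * (1 + m * n - Num.sqrt (1 - n ^+ 2))) in
         0 <= b ->
         extremal_positive_map (Phi3 m n b c))].
Proof.
by split; [exact: Phi1_extremal|exact: Phi2_extremal|exact: Phi3_extremal].
Qed.
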